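(* Fix $s_{\max}>0$. For each $N\in\mathbb N$ let $N_B(N)\ge \lfloor N s_{\max}\rfloor$ and let $E^{(N)}_1,\dots,E^{(N)}_{N_B(N)}$ be real numbers linearly independent over $\mathbb Q$ with weights $d^{(N)}_1,\dots,d^{(N)}_{N_B(N)}>0$. Define $(\Delta Z_N)^2=\sum_{k=1}^N(d_k^{(N)})^2$ and, for $s\in[0,s_{\max}]$, the random process $$W^N_s=\frac{1}{\Delta Z_N}\sum_{j=1}^{\lfloor Ns\rfloor}d^{(N)}_je^{-itE^{(N)}_j},$$ where $t$ is a random time distributed according to the infinite time average. Assume (a) there is $q>1$ such that $\sum_{k=1}^N (d_k^{(N)})^{2q}/\big(\sum_{k=1}^N (d_k^{(N)})^2\big)^q\to0$ as $N\to\infty$, and (b) for all $s,h\ge0$ with $s+h\le s_{\max}$, $$\lim_{N\to\infty}R_1^N(h,s)=h,\qquad R_1^N(h,s):=\frac{\sum_{k=\lfloor Ns\rfloor+1}^{\lfloor N(s+h)\rfloor}(d_k^{(N)})^2}{\sum_{k=1}^N(d_k^{(N)})^2}.$$ Then $W^N$ converges to a planar Wiener process in the sense of finite-dimensional distributions: for every $0\le s_0<s_1<\dots<s_m\le s_{\max}$ the increments $W^N_{s_i}-W^N_{s_{i-1}}$, $i=1,\dots,m$, are mutually independent for every $N$, and each $W^N_{s+h}-W^N_s$ converges in distribution to the isotropic Gaussian on $\mathbb R^2\cong\mathbb C$ with density $\frac{1}{\pi h}e^{-\|\boldsymbol x\|^2/h}$ (so that, after the time rescaling $s=2s'$, $\mathrm{Prob}(|W_{s'+h}-W_{s'}|\le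 r)=\frac1h\int_0^r u\,e^{-u^2/(2h)}du$).
   Context: Infinite time average: $\overline{f(t)}:=\lim_{T\to\infty}\frac1T\int_0^Tf(t)\,dt$; a random variable $F(t)$ with ''$t$ distributed according to the infinite time average'' has as law the limit as $T\to\infty$ of the law of $F(t)$ with $t$ uniform on $[0,T]$. *)

(* Defs.v *)
From HB Require Import structures.
From mathcomp Require Import all_boot all_order all_algebra.
From mathcomp Require Import all_classical all_reals all_analysis.
Set Implicit Arguments. Unset Strict Implicit. Unset Printing Implicit Defensive.
Import Order.TTheory GRing.Theory Num.Theory.
Import numFieldNormedType.Exports.
Local Open Scope classical_set_scope.
Local Open Scope ring_scope.

Section Defs.
Variable R : realType.

Definition Q_lin_indep (n : nat) (E : nat -> R) : Prop :=
  forall c : nat -> rat,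
    \sum_(1 <= j < n.+1) ratr (c j) * E j = 0 ->
    forall j, (1 <= j <= n)%N -> c j = 0.

Definition DeltaZ2 (d : nat -> nat -> R) (N : nat) : R :=
  \sum_(1 <= k < N.+1) d N k ^+ 2.
Definition DeltaZ (d : nat -> nat -> R) (N : nat) : R := Num.sqrt (DeltaZ2 d N).

Definition fl (N : nat) (s : R) : nat := Num.truncn (N%:R * s).

(* W^N_s(t) = (1/Delta Z_N) sum_{j=1}^{floor(N s)} d_j e^{-i t E_j},
   as a point of R^2 = C (real part, imaginary part) *)
Definition W (E d : nat -> nat -> R) (N : nat) (s t : R) : R * R :=
  ((DeltaZ d N)^-1 * \sum_(1 <= j < (fl N s).+1) d N j * cos (t * E N j),
   - ((DeltaZ d N)^-1 * \sum_(1 <= j < (fl N s).+1) d N j * sin (t * E N j))).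

Definition Wincr (E d : nat -> nat -> R) (N : nat) (s s' t : R) : R * R :=
  ((W E d N s' t).1 - (W E d N s t).1, (W E d N s' t).2 - (W E d N s t).2).

Definition R1 (d : nat -> nat -> R) (N : nat) (h s : R) : R :=
  (\sum_((fl N s).+1 <= k < (fl N (s + h)).+1) d N k ^+ 2) / DeltaZ2 d N.

Definition time_avg_cvg (f : R -> R) (l : R) : Prop :=
  (fun T : R => T^-1 * (\int[lebesgue_measure]_(t in `[0, T]) f t))
    @ +oo --> l.

Definition bounded_continuous (T : topologicalType) (g : T -> R) : Prop :=
  continuous g /\ exists M : R, forall x, `|g x| <= M.

Definition gauss2 (h : R) (x : R * R) : R :=
  (pi * h)^-1 * expR (- (x.1 ^+ 2 + x.2 ^+ 2) / h).

Definition int_R2 (f : R * R -> R) : R :=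
  Rintegral ((@lebesgue_measure R) \x (@lebesgue_measure R))%E setT f.

End Defs.

(* Main.v *)
(* Products of trigonometric polynomials in t whose frequencies lie in rationally
   independent families have factoring time averages, because the only frequencies
   with a nonzero mean vanish. A bounded continuous function of finitely many modes is
   a uniform limit of such polynomials (Bernstein), hence the independence of the
   increments for every N.

   For the Gaussian limit, hypothesis (b) alone forces the amplitudes
   d_j / Delta Z_N to be uniformly small. The characteristic function of an increment
   is then computed mode by mode, with an error bounded by the largest amplitude times
   the variance, and tends to exp (- h |xi|^2 / 4), which is the Fourier transform of the
   Gaussian. Finally any bounded continuous g admits a trigonometric polynomial p of the
   plane with |g - p| <= e (1 + |x|^2); as the second moments converge to h, this
   transfers the convergence from characteristic functions to g. *)
Require Import Defs.
From HB Require Import structures.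
From mathcomp Require Import all_boot all_order all_algebra.
From mathcomp Require Import all_classical all_reals all_analysis.
From mathcomp Require Import measurable_realfun ring lra.
Import Order.TTheory GRing.Theory Num.Theory.
Import numFieldNormedType.Exports.
Local Open Scope classical_set_scope.
Local Open Scope ring_scope.

Set Implicit Arguments. Unset Strict Implicit. Unset Printing Implicit Defensive.

(** * Trigonometric polynomials and time averages *)

(** There is no uniform law on the half line, so the time average is accessible only through means
    of bounded continuous functions of the increments, and the existence of each mean is itself to
    be proved. Uniform limits of trigonometric polynomials with controlled frequencies settle both
    points: their means exist, and those with independent frequencies factor. Everything stays real:
    cosines with a free phase replace complex exponentials, and a sine is a cosine with phase -
    pi/2. In the plane, a bounded continuous function is in general no uniform limit of
    trigonometric polynomials; allowing an error that grows like |x|^2 removes this obstacle, and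
    bounded second moments then do the work of tightness. *)

Section TrigPoly.
Variables (R : realType) (X : Type).
Implicit Types (Phi Psi : (X -> R) -> Prop) (f g th : X -> R).

(* Sines are cosines of shifted phases, and products linearize as soon as [Phi]
   is closed under sums and differences. *)
Inductive trigpoly Phi : (X -> R) -> Prop :=
| trigpoly_cos a th : Phi th -> trigpoly Phi (fun x => a * cos (th x))
| trigpolyD f g : trigpoly Phi f -> trigpoly Phi g ->
    trigpoly Phi (fun x => f x + g x).

Lemma eq_trigpoly Phi f g : f =1 g -> trigpoly Phi f -> trigpoly Phi g.
Proof. by move=> /funext ->. Qed.

Lemma sub_trigpoly Phi Psi f : (forall th, Phi th -> Psi th) ->
  trigpoly Phi f -> trigpoly Psi f.
Proof.
move=> PQ; elim=> [a th /PQ|{}f g _ ? _ ?]; first exact: trigpoly_cos.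
exact: trigpolyD.
Qed.

Lemma trigpolyZ Phi c f : trigpoly Phi f -> trigpoly Phi (fun x => c * f x).
Proof.
elim=> [a th Pth|{}f g _ IHf _ IHg].
  by apply: (eq_trigpoly _ (trigpoly_cos (c * a) Pth)) => x; rewrite mulrA.
by apply: (eq_trigpoly _ (trigpolyD IHf IHg)) => x; rewrite mulrDr.
Qed.

Lemma trigpoly_cst Phi c : Phi (fun=> 0) -> trigpoly Phi (fun=> c).
Proof.
by move=> P0; apply: (eq_trigpoly _ (trigpoly_cos c P0)) => x; rewrite cos0 mulr1.
Qed.

Lemma trigpoly_sum Phi (I : Type) (r : seq I) (P : pred I) (F : I -> X -> R) :
  Phi (fun=> 0) -> (forall i, P i -> trigpoly Phi (F i)) ->
  trigpoly Phi (fun x => \sum_(i <- r | P i) F i x).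
Proof.
move=> P0 PF; elim: r => [|i r IHr].
  by apply: (eq_trigpoly _ (trigpoly_cst 0 P0)) => x; rewrite big_nil.
case Pi: (P i); last by apply: (eq_trigpoly _ IHr) => x; rewrite big_cons Pi.
by apply: (eq_trigpoly _ (trigpolyD (PF _ Pi) IHr)) => x; rewrite big_cons Pi.
Qed.

Lemma cosM (a b : R) : cos a * cos b = 2^-1 * cos (a + b) + 2^-1 * cos (a - b).
Proof. by rewrite cosD cosB; field. Qed.

Lemma trigpolyM Phi f g :
  (forall th1 th2, Phi th1 -> Phi th2 ->
     Phi (fun x => th1 x + th2 x) /\ Phi (fun x => th1 x - th2 x)) ->
  trigpoly Phi f -> trigpoly Phi g -> trigpoly Phi (fun x => f x * g x).
Proof.
move=> PD; elim=> [a th1 P1|{}f1 f2 _ IH1 _ IH2] gP.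
  elim: gP => [b th2 P2|g1 g2 _ IH1 _ IH2].
    have [Ps Pd] := PD _ _ P1 P2.
    apply: (eq_trigpoly _ (trigpolyZ (a * b) (trigpolyD
       (trigpoly_cos 2^-1 Ps) (trigpoly_cos 2^-1 Pd)))) => x.
    by rewrite -cosM mulrACA.
  by apply: (eq_trigpoly _ (trigpolyD IH1 IH2)) => x; rewrite mulrDr.
by apply: (eq_trigpoly _ (trigpolyD (IH1 gP) (IH2 gP))) => x; rewrite mulrDl.
Qed.

Lemma trigpoly_bounded Phi f : trigpoly Phi f -> exists2 M, 0 <= M & forall x, `|f x| <= M.
Proof.
elim=> [a th _|{}f g _ [M M0 fM] _ [M' M'0 gM']].
  exists `|a| => // x; rewrite normrM; apply: ler_piMr => //; exact: cos_max.
exists (M + M'); first exact: addr_ge0.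
by move=> x; apply: le_trans (ler_normD _ _) _; apply: lerD.
Qed.

End TrigPoly.

Section Affine.
Variable R : realType.
Implicit Types a c : R.

Lemma continuous_affine a c : continuous (fun x : R => a * x + c).
Proof. by move=> x; apply: cvgD; [apply: cvgM; [exact: cvg_cst|exact: cvg_id]|exact: cvg_cst]. Qed.

Lemma continuous_cos_affine a c : continuous (fun x : R => cos (a * x + c)).
Proof.
move=> x; apply: (@continuous_comp _ _ _ (fun x : R => a * x + c) cos).
  exact: continuous_affine.
exact: continuous_cos.
Qed.

Lemma continuous_sin_affine a c : continuous (fun x : R => sin (a * x + c)).
Proof.
move=> x; apply: (@continuous_comp _ _ _ (fun x : R => a * x + c) sin).
  exact: continuous_affine.
exact: continuous_sin.
Qed.

End Affine.

(** * Means over [0, T] and their limits *)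

Section TimeAverage.
Variable R : realType.
Implicit Types (f g : R -> R) (l T : R).
Local Notation mu := (@lebesgue_measure R).

Definition avg f T := T^-1 * (\int[mu]_(t in `[0, T]) f t).

Lemma continuous_integrable_segment f (a b : R) : continuous f ->
  mu.-integrable `[a, b] (EFin \o f).
Proof.
move=> cf; apply: continuous_compact_integrable; first exact: segment_compact.
exact: continuous_subspaceT.
Qed.

Lemma avgD f g T : continuous f -> continuous g ->
  avg (fun t => f t + g t) T = avg f T + avg g T.
Proof.
move=> cf cg; rewrite /avg RintegralD ?mulrDr//; exact: continuous_integrable_segment.
Qed.

Lemma avgB f g T : continuous f -> continuous g ->
  avg (fun t => f t - g t) T = avg f T - avg g T.
Proof.
move=> cf cg; rewrite /avg RintegralB ?mulrBr//; exact: continuous_integrable_segment.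
Qed.

Lemma avgZ c f T : continuous f -> avg (fun t => c * f t) T = c * avg f T.
Proof.
move=> cf; rewrite /avg RintegralZl// 1?mulrCA//; exact: continuous_integrable_segment.
Qed.

Lemma avg_cst c T : 0 < T -> avg (fun=> c) T = c.
Proof.
move=> T0; rewrite /avg Rintegral_cst//.
have m0T : mu [set` `[0, T]] = T%:E.
  by rewrite [LHS](@lebesgue_measure_itv R)/= lte_fin T0 oppr0 adde0.
rewrite -[X in _ * (_ * X)]/(fine (mu [set` `[0, T]])) m0T.
by rewrite /= mulrC mulfK// gt_eqF.
Qed.

Lemma le_avg f g T : continuous f -> continuous g -> 0 < T ->
  (forall t, f t <= g t) -> avg f T <= avg g T.
Proof.
move=> cf cg T0 fg; rewrite /avg ler_pM2l ?invr_gt0//.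
by apply: le_Rintegral => //; exact: continuous_integrable_segment.
Qed.

Lemma avg_dist f g (e : R) T : continuous f -> continuous g -> 0 < T ->
  (forall t, `|f t - g t| <= e) -> `|avg f T - avg g T| <= e.
Proof.
move=> cf cg T0 fg; rewrite -avgB//.
have cfg : continuous (fun t => f t - g t).
  by move=> t; apply: cvgB; [exact: cf|exact: cg].
rewrite ler_norml -(avg_cst (- e) T0) -{2}(avg_cst e T0).
by apply/andP; split; apply: le_avg => //= t; try exact: cvg_cst;
  move: (fg t); rewrite ler_norml => /andP[].
Qed.

Lemma time_avg_cst c : time_avg_cvg (fun=> c) (c : R).
Proof.
apply: cvg_near_cst; near=> T; rewrite -/(avg _ _) avg_cst//.
Unshelve. all: by end_near. Qed.

Lemma time_avgD f g l l' : continuous f -> continuous g ->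
  time_avg_cvg f l -> time_avg_cvg g l' ->
  time_avg_cvg (fun t => f t + g t) (l + l').
Proof.
move=> cf cg fl gl; rewrite /time_avg_cvg (_ : (fun T => _) = avg f \+ avg g).
  exact: cvgD.
by apply/funext => T; exact: avgD.
Qed.

Lemma time_avgZ c f l : continuous f -> time_avg_cvg f l ->
  time_avg_cvg (fun t => c * f t) (c * l).
Proof.
move=> cf fl; rewrite /time_avg_cvg (_ : (fun T => _) = (fun T => c * avg f T)).
  by apply: cvgM => //; exact: cvg_cst.
by apply/funext => T; exact: avgZ.
Qed.

Lemma time_avg_unique f l l' : time_avg_cvg f l -> time_avg_cvg f l' -> l = l'.
Proof. by move=> fl fl'; apply: (cvg_unique _ fl fl'). Qed.

Lemma le_time_avg f g l l' : continuous f -> continuous g ->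
  (forall t, f t <= g t) -> time_avg_cvg f l -> time_avg_cvg g l' -> l <= l'.
Proof.
move=> cf cg fg fl gl; rewrite -subr_ge0.
apply: (@cvgr_to_ge _ (@pinfty_nbhs R) _ _ (avg g \- avg f)).
  exact: cvgB.
near=> T; rewrite /= subr_ge0; apply: le_avg => //.
Unshelve. all: by end_near. Qed.

(** A uniform error [e] in the function is an error at most [e] in its mean over [0, T], whatever
    [T]; the means of [f] are therefore Cauchy as [T] grows, and no candidate for the limit is
    needed. *)
Lemma time_avg_uniform_limit f : continuous f ->
  (forall e : R, 0 < e -> exists g l, [/\ continuous g, time_avg_cvg g l &
     forall t, `|f t - g t| <= e]) ->
  exists l, time_avg_cvg f l.
Proof.
move=> cf fP; suff : cvg (avg f @ +oo) by move=> ?; exists (lim (avg f @ +oo)).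
apply/cauchy_cvgP/cauchy_exP => e e0.
have [g [l [cg gl fg]]] := fP (e / 2) (divr_gt0 e0 (ltr0Sn _ 1)).
exists l; rewrite /ball/=.
have /cvgrPdist_lt/(_ (e / 2) (divr_gt0 e0 (ltr0Sn _ 1))) gl2 := gl.
near=> T; rewrite -/(ball _ _ _) /ball /=.
have -> : l - avg f T = (l - avg g T) + (avg g T - avg f T) by ring.
apply: le_lt_trans (ler_normD _ _) _.
rewrite [ltRHS]splitr ltr_leD//; first by near: T.
by rewrite distrC avg_dist.
Unshelve. all: by end_near. Qed.

Lemma integral_cos (w ph T : R) : w != 0 -> 0 < T ->
  \int[mu]_(t in `[0, T]) cos (w * t + ph) = (sin (w * T + ph) - sin ph) / w.
Proof.
move=> w0 T0.
have dF (t : R) : is_derive t 1 (fun t => sin (w * t + ph) / w) (cos (w * t + ph)).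
  have dlin : is_derive t 1 (fun t => w * t + ph) w.
    by apply: is_derive_eq; rewrite /GRing.scale/= mulr1 addr0.
  have := @is_derive1_comp _ sin (fun t => w * t + ph) t _ _ (is_derive_sin _) dlin.
  move=> d; apply: is_derive_eq.
  by rewrite scaler0 add0r /GRing.scale/= mulrA mulrAC mulVf ?mul1r//.
have cF : continuous (fun t : R => sin (w * t + ph) / w).
  by move=> t; apply: cvgM; [exact: continuous_sin_affine|exact: cvg_cst].
rewrite /Rintegral (@continuous_FTC2 _ _ (fun t => sin (w * t + ph) / w)) //=.
- by rewrite mulr0 add0r -mulrBl.
- by apply: continuous_subspaceT; exact: continuous_cos_affine.
- by split; [move=> t _; apply: ex_derive
    |apply: cvg_at_right_filter; exact: cF|apply: cvg_at_left_filter; exact: cF].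
- by move=> t _; rewrite derive1E; exact: derive_val.
Qed.

(** For [w != 0] the primitive is bounded by 2 / |w| over every interval, and division by [T]
    removes it; for [w = 0] the function is the constant [cos ph]. *)
Lemma time_avg_cos (w ph : R) :
  time_avg_cvg (fun t => cos (w * t + ph)) ((w == 0)%:R * cos ph).
Proof.
have [->|w0] := eqVneq w 0.
  rewrite mul1r; under [X in time_avg_cvg X]funext do rewrite mul0r add0r.
  exact: time_avg_cst.
rewrite mul0r; apply/cvgrPdist_le => e e0; near=> T.
have T0 : 0 < T by [].
rewrite sub0r normrN integral_cos// normrM (@ger0_norm _ T^-1) ?invr_ge0 ?(ltW T0)//.
rewrite ler_pdivrMl// normrM normrV ?unitfE//.
apply: (@le_trans _ _ (2 / `|w|)).
  rewrite ler_pM2r ?invr_gt0 ?normr_gt0//.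
  apply: le_trans (ler_normB _ _) _; rewrite -[leRHS]/(1 + 1).
  by apply: lerD; exact: sin_max.
rewrite -ler_pdivrMr//; near: T; exact: nbhs_pinfty_ge.
Unshelve. all: by end_near. Qed.

End TimeAverage.

(** * Independence of frequencies *)

Section Independence.
Variable R : realType.
Implicit Types (F G : R -> Prop) (f g p q : R -> R).

(** Only the slope is restricted to [F]; the free offset lets sines enter as shifted cosines. *)
Definition phase F (th : R -> R) :=
  exists w ph, F w /\ forall t, th t = w * t + ph.

Definition additive_freq F :=
  F 0 /\ forall w1 w2, F w1 -> F w2 -> F (w1 + w2) /\ F (w1 - w2).

(* A product of cosines has mean the product of the means unless the two
   frequencies agree up to sign. *)
Definition indep_freq F G :=
  forall w1 w2, F w1 -> G w2 -> w1 = w2 \/ w1 = - w2 -> w1 = 0.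

Lemma phase0 F : additive_freq F -> phase F (fun=> 0).
Proof. by case=> F0 _; exists 0, 0; split=> // t; rewrite mul0r addr0. Qed.

Lemma phaseD F th1 th2 : additive_freq F -> phase F th1 -> phase F th2 ->
  phase F (fun t => th1 t + th2 t) /\ phase F (fun t => th1 t - th2 t).
Proof.
move=> [_ FD] [w1 [ph1 [F1 h1]]] [w2 [ph2 [F2 h2]]]; have [? ?] := FD _ _ F1 F2.
by split; [exists (w1 + w2), (ph1 + ph2)|exists (w1 - w2), (ph1 - ph2)];
  split=> // t; rewrite h1 h2; ring.
Qed.

Lemma trigpoly_phaseM F f g : additive_freq F ->
  trigpoly (phase F) f -> trigpoly (phase F) g ->
  trigpoly (phase F) (fun t => f t * g t).
Proof. by move=> aF; apply: trigpolyM => ? ?; exact: phaseD. Qed.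

Lemma trigpoly_continuous F f : trigpoly (phase F) f -> continuous f.
Proof.
elim=> [a th [w [ph [_ h]]]|{}f g _ cf _ cg] t; last by apply: cvgD; [exact: cf|exact: cg].
apply: cvgM; first exact: cvg_cst.
by rewrite (_ : th = fun t => w * t + ph); [exact: continuous_cos_affine|exact/funext].
Qed.

Lemma time_avg_cos_amp (a w ph : R) :
  time_avg_cvg (fun t => a * cos (w * t + ph)) (a * ((w == 0)%:R * cos ph)).
Proof. by apply: time_avgZ; [exact: continuous_cos_affine|exact: time_avg_cos]. Qed.

Lemma trigpoly_mean F f : trigpoly (phase F) f -> exists l, time_avg_cvg f l.
Proof.
elim=> [a th [w [ph [_ h]]]|{}f g Pf [l fl] Pg [l' gl]].
  exists (a * ((w == 0)%:R * cos ph)).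
  by rewrite (_ : th = fun t => w * t + ph); [exact: time_avg_cos_amp|exact/funext].
by exists (l + l'); apply: time_avgD => //; [exact: trigpoly_continuous Pf|exact: trigpoly_continuous Pg].
Qed.

Lemma continuousMfun f g : continuous f -> continuous g ->
  continuous (fun t => f t * g t).
Proof. by move=> cf cg t; apply: cvgM; [exact: cf|exact: cg]. Qed.

(** Both sides are bilinear, which reduces the claim to two cosines. In the inductive steps the
    given mean of a sum is split by existence of the means of the summands and uniqueness of
    limits. *)
Lemma trigpoly_mean_indep F G f g l l' : indep_freq F G ->
  trigpoly (phase F) f -> trigpoly (phase G) g ->
  time_avg_cvg f l -> time_avg_cvg g l' ->
  time_avg_cvg (fun t => f t * g t) (l * l').
Proof.
move=> FG Pf Pg; elim: Pf l => [a th1 [w1 [ph1 [F1 h1]]] l fl gl|].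
  move: gl.
  elim: Pg l' => [b th2 [w2 [ph2 [G2 h2]]] l' gl|].
    move: fl gl; rewrite (_ : th1 = fun t => w1 * t + ph1); last exact/funext.
    rewrite (_ : th2 = fun t => w2 * t + ph2); last exact/funext.
    move=> /(time_avg_unique (@time_avg_cos_amp a w1 ph1)) <-.
    move=> /(time_avg_unique (@time_avg_cos_amp b w2 ph2)) <-.
    rewrite (_ : (fun t => _) = (fun t =>
        (a * b * 2^-1) * cos ((w1 + w2) * t + (ph1 + ph2)) +
        (a * b * 2^-1) * cos ((w1 - w2) * t + (ph1 - ph2)))); last first.
      apply/funext => t; rewrite mulrACA cosM mulrDr !mulrA.
      by congr (_ * cos _ + _ * cos _); ring.
    have -> : a * ((w1 == 0)%:R * cos ph1) * (b * ((w2 == 0)%:R * cos ph2)) =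
        a * b * 2^-1 * ((w1 + w2 == 0)%:R * cos (ph1 + ph2)) +
        a * b * 2^-1 * ((w1 - w2 == 0)%:R * cos (ph1 - ph2)).
      (* Independence leaves no resonance: the sum, and likewise the difference, vanishes only when
         both frequencies do, and then the two halves add up to [cos ph1 * cos ph2]. *)
      have -> : (w1 + w2 == 0) = (w1 == 0) && (w2 == 0).
        apply/eqP/andP => [w0|[/eqP-> /eqP->]]; last by rewrite addr0.
        have w10 : w1 = 0 by apply: (FG _ _ F1 G2); right; apply/eqP; rewrite -addr_eq0 w0.
        by move: w0; rewrite w10 add0r => ->.
      have -> : (w1 - w2 == 0) = (w1 == 0) && (w2 == 0).
        apply/eqP/andP => [w0|[/eqP-> /eqP->]]; last by rewrite subr0.
        have w10 : w1 = 0 by apply: (FG _ _ F1 G2); left; apply/eqP; rewrite -subr_eq0 w0.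
        by move/eqP: w0; rewrite w10 sub0r oppr_eq0 => ->.
      rewrite cosD cosB; case: (w1 == 0); case: (w2 == 0) => /=; rewrite !(mul0r, mulr0, mul1r, addr0)//.
      by field.
    apply: (@time_avgD _ (fun t => a * b * 2^-1 * cos ((w1 + w2) * t + (ph1 + ph2)))
      (fun t => a * b * 2^-1 * cos ((w1 - w2) * t + (ph1 - ph2))));
      try exact: time_avg_cos_amp.
      by apply: (@trigpoly_continuous setT); apply: trigpoly_cos; exists (w1 + w2), (ph1 + ph2).
    by apply: (@trigpoly_continuous setT); apply: trigpoly_cos; exists (w1 - w2), (ph1 - ph2).
  move=> g1 g2 P1 IH1 P2 IH2 l' gl.
  have [l1 gl1] := trigpoly_mean P1; have [l2 gl2] := trigpoly_mean P2.
  have -> : l' = l1 + l2.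
    by apply: (time_avg_unique gl); apply: time_avgD => //; [exact: trigpoly_continuous P1|exact: trigpoly_continuous P2].
  rewrite mulrDr; under [X in time_avg_cvg X]funext do rewrite mulrDr.
  have cf : continuous (fun t => a * cos (th1 t)).
    by apply: (@trigpoly_continuous F); apply: trigpoly_cos; exists w1, ph1.
  apply: time_avgD; [| |exact: IH1|exact: IH2]; apply: continuousMfun => //.
    exact: trigpoly_continuous P1.
  exact: trigpoly_continuous P2.
move=> f1 f2 P1 IH1 P2 IH2 l fl gl.
have [l1 fl1] := trigpoly_mean P1; have [l2 fl2] := trigpoly_mean P2.
have -> : l = l1 + l2.
  by apply: (time_avg_unique fl); apply: time_avgD => //; [exact: trigpoly_continuous P1|exact: trigpoly_continuous P2].
rewrite mulrDl; under [X in time_avg_cvg X]funext do rewrite mulrDl.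
have cg := trigpoly_continuous Pg.
apply: time_avgD; [| |exact: IH1|exact: IH2]; apply: continuousMfun => //.
  exact: trigpoly_continuous P1.
exact: trigpoly_continuous P2.
Qed.

(** Bohr's almost periodic functions with frequencies in [F], described by uniform approximation. *)
Definition almost_periodic F f := continuous f /\
  forall e, 0 < e -> exists2 p, trigpoly (phase F) p & forall t, `|f t - p t| <= e.

Lemma trigpoly_almost_periodic F f : trigpoly (phase F) f -> almost_periodic F f.
Proof.
move=> Pf; split=> [|e e0]; first exact: trigpoly_continuous Pf.
by exists f => // t; rewrite subrr normr0 ltW.
Qed.

Lemma sub_almost_periodic F G f : (forall w, F w -> G w) ->
  almost_periodic F f -> almost_periodic G f.
Proof.
move=> FG [cf Pf]; split=> // e e0; have [p Pp fp] := Pf e e0; exists p => //.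
by apply: sub_trigpoly Pp => th [w [ph [/FG Gw h]]]; exists w, ph.
Qed.

Lemma almost_periodic_mean F f : almost_periodic F f -> exists l, time_avg_cvg f l.
Proof.
move=> [cf Pf]; apply: time_avg_uniform_limit => // e e0.
have [p Pp fp] := Pf e e0; have [l pl] := trigpoly_mean Pp.
by exists p, l; split=> //; exact: trigpoly_continuous Pp.
Qed.

Lemma almost_periodic_bounded F f : almost_periodic F f ->
  exists2 M, 0 <= M & forall t, `|f t| <= M.
Proof.
move=> [_ /(_ 1 ltr01)[p /trigpoly_bounded[M M0 pM] fp]].
exists (1 + M) => [|t]; first by rewrite addr_ge0.
by rewrite -(subrK (p t) (f t)) (le_trans (ler_normD _ _))// lerD.
Qed.

(** The condition [e <= 1] absorbs the quadratic error term, and the bound involves only the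
    approximated [x] and [y], so the approximants need no bounds of their own. *)
Lemma dist_mul_le (x y a b e : R) : e <= 1 -> `|x - a| <= e -> `|y - b| <= e ->
  `|x * y - a * b| <= (`|x| + `|y| + 1) * e.
Proof.
move=> e1 xa yb; have e0 : 0 <= e := le_trans (normr_ge0 _) xa.
have -> : x * y - a * b = x * (y - b) + y * (x - a) - (x - a) * (y - b) by ring.
apply: le_trans (ler_normB _ _) _; rewrite normrM mulrDl mul1r mulrDl.
apply: lerD; last by rewrite -[leRHS]mul1r; apply: ler_pM => //; exact: le_trans e1.
apply: le_trans (ler_normD _ _) _; rewrite !normrM.
by apply: lerD; apply: ler_wpM2l.
Qed.

(** The witness [e / (K + e)] covers [K = 0] too and is at most 1, as [dist_mul_le] asks. *)
Lemma small_factor (K e : R) : 0 <= K -> 0 < e -> exists2 d, 0 < d <= 1 & K * d <= e.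
Proof.
move=> K0 e0; have s0 : 0 < K + e by rewrite ltr_wpDl.
exists (e / (K + e)); first by rewrite divr_gt0//= ler_pdivrMr// mul1r lerDr.
by rewrite mulrA ler_pdivrMr// mulrC ler_pM2l// lerDl ltW.
Qed.

(** The error [b] may depend on [t]: the quadratic error of the plane approximation is integrated
    through this form. *)
Lemma time_avg_dist_fun f g b l l' m : continuous f -> continuous g -> continuous b ->
  time_avg_cvg f l -> time_avg_cvg g l' -> time_avg_cvg b m ->
  (forall t, `|f t - g t| <= b t) -> `|l - l'| <= m.
Proof.
move=> cf cg cb fl gl bm fg.
have l'l : l' <= l + m.
  apply: (@le_time_avg _ g (fun t => f t + b t)) => // [t|t|].
  - by apply: cvgD; [exact: cf|exact: cb].
  - by have := fg t; rewrite ler_norml => /andP[]; lra.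
  - exact: time_avgD.
have ll' : l <= l' + m.
  apply: (@le_time_avg _ f (fun t => g t + b t)) => // [t|t|].
  - by apply: cvgD; [exact: cg|exact: cb].
  - by have := fg t; rewrite ler_norml => /andP[]; lra.
  - exact: time_avgD.
by rewrite ler_norml; apply/andP; split; lra.
Qed.

Lemma time_avg_dist f g l l' e : continuous f -> continuous g ->
  time_avg_cvg f l -> time_avg_cvg g l' -> (forall t, `|f t - g t| <= e) -> `|l - l'| <= e.
Proof.
move=> cf cg fl gl; apply: (@time_avg_dist_fun _ _ (fun=> e) _ _ _ cf cg _ fl gl).
  by move=> ?; exact: cvg_cst.
exact: time_avg_cst.
Qed.

Lemma almost_periodicM F f g : additive_freq F ->
  almost_periodic F f -> almost_periodic F g -> almost_periodic F (fun t => f t * g t).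
Proof.
move=> aF APf APg.
have [A A0 fA] := almost_periodic_bounded APf; have [B B0 gB] := almost_periodic_bounded APg.
case: APf => cf Pf; case: APg => cg Pg; split=> [|e e0]; first exact: continuousMfun.
have K0 : 0 <= A + B + 1 by rewrite !addr_ge0.
have [d /andP[d0 d1] Kd] := small_factor K0 e0.
have [p Pp fp] := Pf d d0; have [q Pq gq] := Pg d d0.
exists (fun t => p t * q t) => [|t]; first exact: trigpoly_phaseM.
apply: le_trans (dist_mul_le d1 (fp t) (gq t)) _; apply: le_trans Kd.
by rewrite ler_wpM2r// ?(ltW d0)// lerD// lerD.
Qed.

Lemma almost_periodic_mean_indep F G f g l l' : indep_freq F G ->
  almost_periodic F f -> almost_periodic G g ->
  time_avg_cvg f l -> time_avg_cvg g l' ->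
  time_avg_cvg (fun t => f t * g t) (l * l').
Proof.
move=> FG APf APg fl gl.
have [A A0 fA] := almost_periodic_bounded APf; have [B B0 gB] := almost_periodic_bounded APg.
case: APf => cf Pf; case: APg => cg Pg.
have cfg := continuousMfun cf cg.
(* [K] serves two product estimates at once: that of the functions, bounded by [A] and [B], and that
   of their means [l] and [l']. *)
pose K := `|l| + `|l'| + 1 + (A + B + 1).
have K0 : 0 <= K by rewrite !addr_ge0.
have approx e : 0 < e -> exists h m, [/\ continuous h, time_avg_cvg h m,
    forall t, `|f t * g t - h t| <= e & `|l * l' - m| <= e].
  move=> e0; have [d /andP[d0 d1] Kd] := small_factor K0 e0.
  have [p Pp fp] := Pf d d0; have [q Pq gq] := Pg d d0.
  have [a pa] := trigpoly_mean Pp; have [b qb] := trigpoly_mean Pq.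
  have cp := trigpoly_continuous Pp; have cq := trigpoly_continuous Pq.
  exists (fun t => p t * q t), (a * b); split.
  - exact: continuousMfun.
  - exact: trigpoly_mean_indep FG Pp Pq pa qb.
  - move=> t; apply: le_trans (dist_mul_le d1 (fp t) (gq t)) _; apply: le_trans Kd.
    rewrite ler_wpM2r ?(ltW d0)//; apply: (@le_trans _ _ (A + B + 1)).
      by rewrite lerD2r lerD.
    by rewrite /K lerDr !addr_ge0.
  - have la := time_avg_dist cf cp fl pa fp; have lb := time_avg_dist cg cq gl qb gq.
    apply: le_trans (dist_mul_le d1 la lb) _; apply: le_trans Kd.
    by rewrite ler_wpM2r ?(ltW d0)// /K lerDl !addr_ge0.
have [L fgL] : exists L, time_avg_cvg (fun t => f t * g t) L.
  apply: time_avg_uniform_limit => // e /approx[h [m [ch hm fgh _]]].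
  by exists h, m.
suff -> : l * l' = L by [].
apply/eqP; rewrite -subr_eq0 -normr_le0; apply/ler_addgt0Pr => e e0; rewrite add0r.
have [h [m [ch hm fgh lm]]] := approx (e / 2) (divr_gt0 e0 (ltr0Sn _ 1)).
have := time_avg_dist cfg ch fgL hm fgh.
rewrite -[l * l'](subrK m) -addrA => Lm.
by rewrite (le_trans (ler_normD _ _))// [leRHS]splitr lerD// distrC.
Qed.

End Independence.

(** * Rational spans of sets of frequencies *)

Section Frequencies.
Variables (R : realType) (n : nat) (E : nat -> R).

(** The sum always runs over 1..n and [P] constrains the coefficients instead, so that combinations
    over different index sets add term by term. *)
Definition freq (P : pred nat) (w : R) := exists2 c : nat -> rat,
  (forall j, ~~ P j -> c j = 0) & w = \sum_(1 <= j < n.+1) ratr (c j) * E j.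

Lemma freq_additive P : additive_freq (freq P).
Proof.
split; first by exists (fun=> 0) => //; rewrite big1// => j _; rewrite rmorph0 mul0r.
move=> w1 w2 [c1 P1 ->] [c2 P2 ->]; split.
  exists (fun j => c1 j + c2 j) => [j Pj|]; first by rewrite P1// P2// addr0.
  by rewrite -big_split; apply: eq_bigr => j _; rewrite rmorphD mulrDl.
exists (fun j => c1 j - c2 j) => [j Pj|]; first by rewrite P1// P2// subr0.
by rewrite -sumrB; apply: eq_bigr => j _; rewrite rmorphB mulrBl.
Qed.

Lemma sub_freq (P Q : pred nat) w : (forall j, P j -> Q j) -> freq P w -> freq Q w.
Proof. by move=> PQ [c cP ->]; exists c => // j /(contra (PQ j)); exact: cP. Qed.

Lemma freq_gen (P : pred nat) j : (1 <= j <= n)%N -> P j -> freq P (E j).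
Proof.
move=> /andP[j1 jn] Pj; exists (fun k => (k == j)%:R) => [k|].
  by have [->|//] := eqVneq k j; rewrite Pj.
rewrite (bigD1_seq j)/= ?iota_uniq ?mem_index_iota ?j1 ?ltnS//= eqxx rmorph1 mul1r.
rewrite big1 ?addr0// => k /negbTE ->; by rewrite rmorph0 mul0r.
Qed.

(** An equality w1 = w2 or w1 = - w2 is a rational relation [w1 + ratr s * w2 = 0]. At an index in
    [P] its coefficient is [c1 j], as [c2] vanishes there, so linear independence kills [c1]. *)
Lemma freq_indep (P Q : pred nat) : Q_lin_indep n E -> (forall j, P j -> ~~ Q j) ->
  indep_freq (freq P) (freq Q).
Proof.
move=> indE PQ w1 w2 [c1 P1 e1] [c2 P2 e2] w12.
suff c10 j : (1 <= j <= n)%N -> c1 j = 0.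
  rewrite e1 big_nat_cond big1// => j /andP[/andP[j1 jn] _].
  by rewrite c10 ?rmorph0 ?mul0r// j1 -ltnS.
move=> jn; have [s s12] : exists s : rat, w1 + ratr s * w2 = 0.
  case: w12 => ->; first by exists (-1); rewrite rmorphN rmorph1 mulN1r subrr.
  by exists 1; rewrite rmorph1 mul1r addNr.
case Pj : (P j); last by rewrite P1 ?Pj.
suff : c1 j + s * c2 j = 0 by rewrite (P2 _ (PQ _ Pj)) mulr0 addr0.
apply: (indE (fun j => c1 j + s * c2 j)) jn; apply: etrans s12.
rewrite e1 e2 mulr_sumr -big_split/=; apply: eq_bigr => k _.
by rewrite rmorphD rmorphM mulrDl mulrA.
Qed.

End Frequencies.

(** * Bernstein approximation in the plane *)

Section Bernstein.
Variable R : realType.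
Implicit Types (u v c e : R) (f g : nat -> R) (h : R * R -> R).

(* The Bernstein operator [sum_k 'C(n, k) u^k (1 - u)^(n - k) f k] as the
   expectation of [f] at the end of an [n]-step walk with success probability [u]. *)
Fixpoint bern u n f : R :=
  if n is m.+1 then (1 - u) * bern u m f + u * bern u m (fun k => f k.+1) else f 0%N.

(** Second moment of a binomial variable, squared mean plus variance. The shift [c] absorbs the step
    from k to k + 1 and makes the induction close. *)
Lemma bern_affine_sqr (a b u c : R) n : bern u n (fun k => a + b * (k%:R + c) ^+ 2) =
  a + b * ((n%:R * u + c) ^+ 2 + n%:R * (u * (1 - u))).
Proof.
elim: n c => [|n IHn] c /=; first by rewrite !mul0r addr0 add0r.
under [X in _ + _ * bern _ _ X]funext do rewrite -addn1 natrD -addrA.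
by rewrite !IHn -[n.+1]addn1 natrD; ring.
Qed.

Lemma bern_dist u c n f g : 0 <= u <= 1 -> (forall k, (k <= n)%N -> `|c - f k| <= g k) ->
  `|c - bern u n f| <= bern u n g.
Proof.
move=> /andP[u0 u1]; elim: n f g => [|n IHn] f g fg /=; first exact: fg.
have -> : c - ((1 - u) * bern u n f + u * bern u n (fun k => f k.+1)) =
  (1 - u) * (c - bern u n f) + u * (c - bern u n (fun k => f k.+1)) by ring.
apply: le_trans (ler_normD _ _) _; rewrite !normrM (ger0_norm u0) (@ger0_norm _ (1 - u)) ?subr_ge0//.
by apply: lerD; apply: ler_wpM2l; rewrite ?subr_ge0//; apply: IHn => k kn; apply: fg => //; exact: leqW.
Qed.

(** Chebyshev's argument: a quadratic error integrates exactly against the two walks, where each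
    coordinate contributes a variance u (1 - u) / n <= 1 / n, whence the factor 2. *)
Lemma bern2_dist u v c n e C (f : nat -> nat -> R) : 0 <= u <= 1 -> 0 <= v <= 1 ->
  0 <= C -> (0 < n)%N ->
  (forall k l, (k <= n)%N -> (l <= n)%N ->
    `|c - f k l| <= e + C * ((u - k%:R / n%:R) ^+ 2 + (v - l%:R / n%:R) ^+ 2)) ->
  `|c - bern u n (fun k => bern v n (f k))| <= e + C * 2 / n%:R.
Proof.
move=> u01 v01 C0 n0 fP.
have nz : n%:R != 0 :> R by rewrite pnatr_eq0 -lt0n.
have sqE w k : C * (w - k%:R / n%:R) ^+ 2 = C / n%:R ^+ 2 * (k%:R + - (n%:R * w)) ^+ 2 :> R.
  by field.
have vb k : (k <= n)%N -> `|c - bern v n (f k)| <=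
    (e + C * (v * (1 - v)) / n%:R) + C / n%:R ^+ 2 * (k%:R + - (n%:R * u)) ^+ 2.
  move=> kn; have /(bern_dist v01) : forall l, (l <= n)%N -> `|c - f k l| <=
      (e + C / n%:R ^+ 2 * (k%:R + - (n%:R * u)) ^+ 2) +
      C / n%:R ^+ 2 * (l%:R + - (n%:R * v)) ^+ 2.
    by move=> l ln; rewrite -!sqE -addrA -mulrDr; exact: fP.
  rewrite bern_affine_sqr subrr expr0n/= add0r => /le_trans; apply.
  rewrite le_eqVlt; apply/orP; left; apply/eqP; by field.
have := bern_dist u01 vb; rewrite bern_affine_sqr subrr expr0n/= add0r => /le_trans; apply.
have w1 w : 0 <= w <= 1 -> w * (1 - w) <= 1 :> R by move=> /andP[? ?]; nra.
have -> : e + C * (v * (1 - v)) / n%:R + C / n%:R ^+ 2 * (n%:R * (u * (1 - u))) =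
  e + C * (v * (1 - v) + u * (1 - u)) / n%:R by field.
rewrite lerD2l ler_wpM2r ?invr_ge0// ler_wpM2l//.
by rewrite -[2]/(1 + 1)%R lerD// w1.
Qed.

Lemma bounded_continuous_modulus h : bounded_continuous h -> forall e, 0 < e ->
  exists2 C, 0 <= C & forall p q : R * R, 0 <= p.1 <= 1 -> 0 <= p.2 <= 1 ->
    `|h p - h q| <= e + C * ((p.1 - q.1) ^+ 2 + (p.2 - q.2) ^+ 2).
Proof.
move=> [ch [M hM]] e e0.
have M0 : 0 <= M := le_trans (normr_ge0 _) (hM (0, 0)).
pose K : set (R * R) := `[0, 1] `*` `[0, 1].
have : near_covering K.
  by apply/compact_near_coveringP/compact_setX; exact: segment_compact.
(* Compactness is used as a near covering, with the radius [d] tending to 0 from the right as the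
   parameter; [q] may leave the square. *)
move=> /(_ R (0^'+) (fun d p => forall q : R * R, `|p.1 - q.1| < d -> `|p.2 - q.2| < d ->
    `|h p - h q| <= e)).
case=> [x Kx|d d0 dP].
  have /cvgrPdist_lt/(_ (e / 2) (divr_gt0 e0 (ltr0Sn _ 1))) := ch x.
  move=> /nbhs_ballP[r /= r0 xr].
  exists (ball x (r / 2), [set d | d < r / 2]).
    split; first by apply: nbhsx_ballx; rewrite divr_gt0.
    by apply: nbhs_right_lt; rewrite divr_gt0.
  move=> [p d]/= [[xp1 xp2] dr] q pq1 pq2.
  have hp : `|h x - h p| < e / 2.
    have r2 : r / 2 < r by lra.
    by apply: xr; split; [exact: lt_trans xp1 r2|exact: lt_trans xp2 r2].
  have hq : `|h x - h q| < e / 2.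
    have t1 := ler_distD p.1 x.1 q.1; have t2 := ler_distD p.2 x.2 q.2.
    have p1 : `|x.1 - p.1| < r / 2 by exact: xp1.
    have p2 : `|x.2 - p.2| < r / 2 by exact: xp2.
    by apply: xr; split; rewrite /ball/=; lra.
  rewrite -[h p](subrK (h x)) -addrA [leRHS]splitr; apply: le_trans (ler_normD _ _) _.
  by rewrite distrC lerD// ltW.
have {}dP : forall p q : R * R, K p -> `|p.1 - q.1| < d / 2 -> `|p.2 - q.2| < d / 2 ->
    `|h p - h q| <= e.
  move=> p q Kp; apply: (dP (d / 2)) => //=; last by rewrite divr_gt0.
  by rewrite sub0r normrN gtr0_norm ?divr_gt0//; move: d0 => /= d0; lra.
have dd : 0 < d / 2 by rewrite divr_gt0.
exists (2 * M / (d / 2) ^+ 2) => [|p q p1 p2]; first by apply: divr_ge0; [exact: mulr_ge0|exact: sqr_ge0].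
have big (s t : R) : 0 <= t -> d / 2 <= `|s| ->
    `|h p - h q| <= e + 2 * M / (d / 2) ^+ 2 * (s ^+ 2 + t).
  move=> t0 ds; have sd : (d / 2) ^+ 2 <= s ^+ 2.
    by rewrite -[s ^+ 2]real_normK ?num_real// ler_pXn2r// nnegrE ltW.
  apply: (@le_trans _ _ (2 * M)).
    by apply: le_trans (ler_normB _ _) _; rewrite mulr_natl mulr2n lerD.
  apply: ler_wpDl; first exact: ltW.
  rewrite mulrAC ler_pdivlMr ?exprn_gt0// ler_wpM2l ?mulr_ge0//.
  by apply: le_trans sd _; rewrite lerDl.
case: (ltP `|p.1 - q.1| (d / 2)) => [d1|]; last by apply: big; exact: sqr_ge0.
case: (ltP `|p.2 - q.2| (d / 2)) => [d2|]; last by rewrite [_ + _ ^+ 2]addrC; apply: big; exact: sqr_ge0.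
apply: le_trans (dP _ _ _ d1 d2) _; first by split; rewrite /= in_itv.
rewrite lerDl; apply: mulr_ge0; last by apply: addr_ge0; exact: sqr_ge0.
by apply: divr_ge0; [exact: mulr_ge0|exact: sqr_ge0].
Qed.

(** [A] is any algebra of functions with constants; it is instantiated by trigonometric polynomials
    in [t] and by those of the plane. *)
Lemma bernstein_approx (X : Type) (A : (X -> R) -> Prop) (u v : X -> R) h :
  (forall c, A (fun=> c)) -> (forall f g : X -> R, A f -> A g -> A (fun x => f x + g x)) ->
  (forall f g : X -> R, A f -> A g -> A (fun x => f x * g x)) ->
  A u -> A v -> (forall x, 0 <= u x <= 1) -> (forall x, 0 <= v x <= 1) ->
  bounded_continuous h -> forall e, 0 < e ->
  exists2 p, A p & forall x, `|h (u x, v x) - p x| <= e.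
Proof.
move=> Acst AD AM Au Av u01 v01 bh e e0.
have Abern w n (f : nat -> X -> R) : A w -> (forall k, A (f k)) ->
    A (fun x => bern (w x) n (fun k => f k x)).
  move=> Aw; elim: n f => [|n IHn] f Af //=.
  apply: (AD (fun x => (1 - w x) * _) (fun x => w x * _)); apply: (AM) => //; try exact: IHn.
  rewrite (_ : (fun x => 1 - w x) = (fun x => 1 + -1 * w x)).
    by apply: (AD (fun=> 1) (fun x => -1 * w x)) => //; apply: (AM (fun=> -1)).
  by apply/funext => x; rewrite mulN1r.
have e2 : 0 < e / 2 by rewrite divr_gt0.
have [C C0 hC] := bounded_continuous_modulus bh e2.
have [n n0 nP] : exists2 n : nat, (0 < n)%N & C * 2 / n%:R <= e / 2.
  exists (Num.truncn (C * 2 / (e / 2))).+1 => //.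
  have := truncnS_gt (C * 2 / (e / 2)); rewrite ltr_pdivrMr// => /ltW.
  by rewrite ler_pdivrMr// (mulrC (e / 2)).
exists (fun x => bern (u x) n (fun k => bern (v x) n (fun l => h (k%:R / n%:R, l%:R / n%:R)))).
  by apply: (Abern u n (fun k x => bern (v x) n (fun l => h (k%:R / n%:R, l%:R / n%:R)))) => // k;
    apply: (Abern v n (fun l x => h (k%:R / n%:R, l%:R / n%:R))).
move=> x; rewrite [leRHS]splitr; apply: le_trans (lerD (lexx _) nP).
by apply: bern2_dist => // k l _ _; apply: hC; [exact: u01|exact: v01].
Qed.

(** * Trigonometric approximation in time and in the plane *)

Definition linphase (th : R * R -> R) :=
  exists a b c, forall x, th x = a * x.1 + b * x.2 + c.

Lemma linphase0 : linphase (fun=> 0).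
Proof. by exists 0, 0, 0 => x; rewrite !mul0r !addr0. Qed.

Lemma linphaseD th1 th2 : linphase th1 -> linphase th2 ->
  linphase (fun x => th1 x + th2 x) /\ linphase (fun x => th1 x - th2 x).
Proof.
move=> [a1 [b1 [c1 h1]]] [a2 [b2 [c2 h2]]].
by split; [exists (a1 + a2), (b1 + b2), (c1 + c2)|exists (a1 - a2), (b1 - b2), (c1 - c2)];
  move=> x; rewrite h1 h2; ring.
Qed.

Lemma continuous_pair2 (T : topologicalType) (f g : T -> R) :
  continuous f -> continuous g -> continuous (fun x => (f x, g x)).
Proof. by move=> cf cg x; exact: (cvg_pair (cf x) (cg x)). Qed.

Lemma bounded_continuous_comp (h : R * R -> R) (s : R -> R) : continuous s ->
  bounded_continuous h -> bounded_continuous (fun x : R * R => h (s x.1, s x.2)).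
Proof.
move=> cs [ch [M hM]]; split; last by exists M.
move=> x; apply: (@continuous_comp _ _ _ (fun x : R * R => (s x.1, s x.2)) h); last exact: ch.
by apply: continuous_pair2 => {}x; apply: continuous_comp; try exact: cs;
  [exact: cvg_fst|exact: cvg_snd].
Qed.

Lemma almost_periodic_comp (F : R -> Prop) (h : R * R -> R) (f g : R -> R) : additive_freq F ->
  bounded_continuous h -> trigpoly (phase F) f -> trigpoly (phase F) g ->
  almost_periodic F (fun t => h (f t, g t)).
Proof.
move=> aF bh Pf Pg; split.
  move=> t; apply: (@continuous_comp _ _ _ (fun t => (f t, g t)) h); last exact: bh.1.
  by apply: continuous_pair2; [exact: trigpoly_continuous Pf|exact: trigpoly_continuous Pg].
move=> e e0; have [A A0 fA] := trigpoly_bounded Pf; have [B B0 gB] := trigpoly_bounded Pg.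
(* A common bound for both functions; the 1 keeps it positive. The affine map below carries [-S, S]
   onto [0, 1], where Bernstein polynomials live, and [cs] concerns its inverse, which is composed
   into [h]. *)
pose S := A + B + 1; have S0 : 0 < S by rewrite ltr_wpDl// addr_ge0.
have scale (k : R -> R) : trigpoly (phase F) k -> (forall t, `|k t| <= S) ->
    trigpoly (phase F) (fun t => (2 * S)^-1 * k t + 2^-1) /\
    forall t, 0 <= (2 * S)^-1 * k t + 2^-1 <= 1.
  move=> Pk kS; split.
    by apply: trigpolyD; [exact: trigpolyZ|apply: trigpoly_cst; exact: phase0].
  move=> t; have := kS t; rewrite ler_norml => /andP[k1 k2].
  have -> : (2 * S)^-1 * k t + 2^-1 = (k t + S) / (2 * S).
    by field; rewrite gt_eqF.
  rewrite divr_ge0 ?mulr_ge0 ?(ltW S0)//; last by lra.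
  by rewrite ler_pdivrMr ?mulr_gt0// mul1r; lra.
have [|Pu u01] := scale f Pf; first by move=> t; apply: le_trans (fA t) _; rewrite /S; lra.
have [|Pv v01] := scale g Pg; first by move=> t; apply: le_trans (gB t) _; rewrite /S; lra.
have cs : continuous (fun x : R => 2 * S * (x - 2^-1)).
  move=> x; apply: cvgM; first exact: cvg_cst.
  by apply: cvgB; [exact: cvg_id|exact: cvg_cst].
have [|||p Pp hp] := bernstein_approx _ _ _ Pu Pv u01 v01 (bounded_continuous_comp cs bh) e0.
- by move=> c; apply: trigpoly_cst; exact: phase0.
- by move=> ? ?; exact: trigpolyD.
- by move=> ? ?; exact: trigpoly_phaseM.
exists p => // t; have := hp t; rewrite /= !addrK !mulrA.
by rewrite divff ?mul1r// mulf_neq0 ?gt_eqF.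
Qed.

(* [sin (x / 2L)] sends the plane into the square [-1, 1]^2 and is inverted on the
   box |x_i| <= L by a continuous function, so Bernstein polynomials in it are
   trigonometric polynomials that approximate on the box and stay bounded outside. *)
Lemma trigpoly_approx (g : R * R -> R) : bounded_continuous g -> forall e, 0 < e ->
  exists2 p, trigpoly linphase p &
    forall x, `|g x - p x| <= e * (1 + (x.1 ^+ 2 + x.2 ^+ 2)).
Proof.
move=> bg e e0; have [cg [M gM]] := bg.
have M0 : 0 <= M := le_trans (normr_ge0 _) (gM (0, 0)).
(* [L] is such that 2 M <= e L^2: off the box, the largest possible error 2 M is then paid for by e
   |x|^2. The added 1 gives L <= L^2. *)
pose L : R := 2 * M / e + 1; have L1 : 1 <= L by rewrite lerDr divr_ge0 ?mulr_ge0 ?(ltW e0).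
have L0 : 0 < L by exact: lt_le_trans L1.
have ML : 2 * M <= e * L ^+ 2.
  have : 2 * M <= e * L by rewrite mulrDr mulr1 mulrCA divff ?gt_eqF// mulr1 lerDl ltW.
  move=> /le_trans; apply; rewrite ler_pM2l// expr2 -[leLHS]mulr1 ler_pM2l//.
pose c : R := sin 2^-1.
have pi2 := @pihalf_ge1 R.
have itv_half (y : R) : `|y| <= 2^-1 -> y \in `[- (pi / 2), pi / 2].
  by rewrite ler_norml in_itv/= => /andP[? ?]; apply/andP; split; lra.
have c1 : c < 1.
  by rewrite -(@sin_pihalf R) ltr_sin ?in_itv/=; try (apply/andP; split); lra.
have c0 : 0 < c by apply: sin_gt0_pihalf; apply/andP; split; lra.
(* Clipping at c = sin (1/2) < 1 keeps the arcsine inside its open interval of continuity and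
   changes nothing on the box, where |y / (2 L)| <= 1/2. *)
pose clip (y : R) := Num.max (- c) (Num.min c y).
have clipP y : - c <= clip y <= c.
  by rewrite /clip le_max lexx/= ge_max ge_min lexx/= andbT; lra.
pose s (y : R) := 2 * L * asin (clip (2 * y - 1)).
have cs : continuous s.
  move=> y; apply: cvgM; first exact: cvg_cst.
  have /andP[l1 l2] := clipP (2 * y - 1).
  apply: (@continuous_comp _ _ _ (fun y : R => clip (2 * y - 1)) asin); last first.
    by apply: continuous_asin; apply/andP; split; lra.
  apply: (@continuous_max _ _ (fun=> - c) (fun y : R => Num.min c (2 * y - 1))); first exact: cvg_cst.
  apply: (@continuous_min _ _ (fun=> c) (fun y : R => (2 * y - 1))); first exact: cvg_cst.
  by apply: cvgB; [apply: cvgM; [exact: cvg_cst|exact: cvg_id]|exact: cvg_cst].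
have sE (y : R) : `|y| <= L -> s (2^-1 * sin (y / (2 * L)) + 2^-1) = y.
  move=> yL; have zh : `|y / (2 * L)| <= 2^-1.
    rewrite normrM (@gtr0_norm _ (2 * L)^-1) ?invr_gt0 ?mulr_gt0//.
    by rewrite ler_pdivrMr ?mulr_gt0// mulrA mulVf// mul1r.
  have /andP[z1 z2] : - c <= sin (y / (2 * L)) <= c.
    rewrite -sinN /c; move: (zh); rewrite ler_norml => /andP[? ?].
    have hh : `|2^-1| <= 2^-1 :> R by rewrite ger0_norm//; lra.
    by apply/andP; split; rewrite leNgt ltr_sin ?itv_half ?normrN// -leNgt.
  have -> : s (2^-1 * sin (y / (2 * L)) + 2^-1) = 2 * L * asin (clip (sin (y / (2 * L)))).
    by rewrite /s; congr (_ * asin (clip _)); field.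
  rewrite /clip (min_idPr z2) (max_idPr z1) sinK ?itv_half//.
  by field; rewrite gt_eqF.
pose u i (x : R * R) : R := 2^-1 * sin ((if i then x.1 else x.2) / (2 * L)) + 2^-1.
have Pu i : trigpoly linphase (u i).
  apply: trigpolyD; last by apply: trigpoly_cst; exact: linphase0.
  under [X in trigpoly _ X]funext do rewrite -cosBpihalf.
  apply: trigpoly_cos; exists (if i then (2 * L)^-1 else 0), (if i then 0 else (2 * L)^-1), (- (pi / 2)).
  by case: i => x; rewrite mul0r ?addr0 ?add0r mulrC.
have u01 i x : 0 <= u i x <= 1.
  have := sin_max ((if i then x.1 else x.2) / (2 * L)).
  by rewrite /u ler_norml => /andP[? ?]; apply/andP; split; lra.
have [|||p Pp hp] := bernstein_approx _ _ _ (Pu true) (Pu false) (u01 true) (u01 false)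
  (bounded_continuous_comp cs bg) e0.
- by move=> ?; apply: trigpoly_cst; exact: linphase0.
- by move=> ? ?; exact: trigpolyD.
- by move=> ? ?; apply: trigpolyM => ? ?; exact: linphaseD.
exists p => // x; set r := x.1 ^+ 2 + x.2 ^+ 2.
have r0 : 0 <= r by rewrite addr_ge0 ?sqr_ge0.
rewrite -[g x](subrK (g (s (u true x), s (u false x)))) -addrA mulrDr mulr1 addrC.
rewrite [e + _]addrC.
have far (y z : R) : L < `|y| -> r = y ^+ 2 + z ^+ 2 ->
    `|g x - g (s (u true x), s (u false x))| <= e * r.
  move=> Ly ->; apply: le_trans (ler_normB _ _) _.
  apply: (@le_trans _ _ (2 * M)); first by rewrite mulr_natl mulr2n lerD.
  apply: le_trans ML _; rewrite ler_pM2l//; apply: ler_wpDr; first exact: sqr_ge0.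
  by rewrite -[y ^+ 2]real_normK ?num_real// ler_pXn2r ?nnegrE ?(ltW L0)// ltW.
rewrite [X in `|X|]addrC; apply: le_trans (ler_normD _ _) _; apply: lerD; last exact: hp.
case: (ltP L `|x.1|) => [/far|x1]; first exact.
case: (ltP L `|x.2|) => [/far|x2]; first by apply; rewrite /r addrC.
by rewrite /u !sE// -surjective_pairing subrr normr0 mulr_ge0 ?(ltW e0).
Qed.

End Bernstein.

(** * Gaussian integrals *)

Section Gaussian.
Variables (R : realType) (h : R).
Hypothesis h0 : 0 < h.
Implicit Types (x y a b c : R).
Local Notation mu := (@lebesgue_measure R).

(** The centred normal density of variance [h / 2]. The parameter is explicit because the width
    [2 * h] also occurs, as a majorant. *)
Definition gauss1 (h x : R) : R := (Num.sqrt (pi * h))^-1 * expR (- x ^+ 2 / h).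

Lemma gauss1_ge0 (k x : R) : 0 <= gauss1 k x.
Proof. by rewrite mulr_ge0 ?invr_ge0 ?expR_ge0. Qed.

Lemma normrM_gauss1 (k u x : R) : `|u * gauss1 k x| = `|u| * gauss1 k x.
Proof. by rewrite normrM [X in _ * X]ger0_norm ?gauss1_ge0. Qed.

Lemma gauss1E (k : R) : 0 < k -> gauss1 k = normal_pdf 0 (Num.sqrt (k / 2)).
Proof.
move=> k0; have s0 : Num.sqrt (k / 2) != 0 by rewrite gt_eqF// sqrtr_gt0 divr_gt0.
apply/funext => x; rewrite normal_pdfE// /normal_peak /normal_fun /gauss1 subr0.
rewrite sqr_sqrtr ?divr_ge0 ?(ltW k0)//.
by congr ((Num.sqrt _)^-1 * expR (- _ / _)); rewrite -mulr_natr; field.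
Qed.

Lemma gauss2E x y : gauss2 h (x, y) = gauss1 h x * gauss1 h y.
Proof.
rewrite /gauss2 /gauss1 /= mulrACA -expRD -invfM -expr2 sqr_sqrtr ?mulr_ge0 ?pi_ge0 ?(ltW h0)//.
by congr (_ * expR _); rewrite mulNr mulrDl opprD !mulNr.
Qed.

Lemma gauss1_continuous (k : R) : 0 < k -> continuous (gauss1 k).
Proof.
by move=> k0; rewrite gauss1E//; apply: continuous_normal_pdf; rewrite gt_eqF// sqrtr_gt0 divr_gt0.
Qed.

Lemma integrable_gauss1 (k : R) : 0 < k -> mu.-integrable setT (EFin \o gauss1 k).
Proof. by move=> k0; rewrite gauss1E//; exact: integrable_normal_pdf. Qed.

Lemma Rintegral_gauss1 (k : R) : 0 < k -> \int[mu]_x gauss1 k x = 1.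
Proof. by move=> k0; rewrite gauss1E// /Rintegral integral_normal_pdf. Qed.

(** With y = x^2 / (2 h), the inequality y <= e^y trades the factor x^2 for half of the exponent;
    [K] is 2 h times the ratio of the normalizations of [gauss1 h] and [gauss1 (2 * h)]. *)
Lemma integrable_sqr_gauss1 : mu.-integrable setT (fun x => (x ^+ 2 * gauss1 h x)%:E).
Proof.
have h20 : 0 < 2 * h by rewrite mulr_gt0.
pose K := 2 * h * (Num.sqrt (pi * h))^-1 / (Num.sqrt (pi * (2 * h)))^-1.
have /le_integrable : mu.-integrable setT (fun x => K%:E * (gauss1 (2 * h) x)%:E)%E.
  by apply: integrableZl => //; exact: integrable_gauss1.
apply => //.
  apply/measurable_EFinP; apply: measurable_funM => //.
  by apply: continuous_measurable_fun; exact: gauss1_continuous.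
move=> x _; rewrite -EFinM !abse_EFin lee_fin !normrM_gauss1 ger0_norm ?sqr_ge0//.
rewrite ger0_norm; last by rewrite !mulr_ge0 ?invr_ge0 ?(ltW h0).
rewrite /gauss1 /K [leRHS]mulrA divfK ?invr_eq0 ?gt_eqF ?sqrtr_gt0 ?mulr_gt0 ?pi_gt0//.
set p := (Num.sqrt (pi * h))^-1; have p0 : 0 <= p by rewrite invr_ge0.
rewrite mulrCA [2 * h * p]mulrC -[p * _ * _]mulrA; apply: ler_wpM2l => //.
have -> : - x ^+ 2 / h = - x ^+ 2 / (2 * h) + - (x ^+ 2 / (2 * h)).
  by field; rewrite gt_eqF.
rewrite expRD mulrCA [X in _ <= X]mulrC; apply: ler_wpM2l; first exact: expR_ge0.
rewrite expRN ler_pdivrMr ?expR_gt0// mulrC -ler_pdivrMr//.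
by rewrite mulrC (le_trans _ (expR_ge1Dx _))// lerDr.
Qed.

Lemma integrable_gauss1M (u : R -> R) C : measurable_fun setT u ->
  (forall x, `|u x| <= C * (1 + x ^+ 2)) ->
  mu.-integrable setT (fun x => (u x * gauss1 h x)%:E).
Proof.
move=> mu_ uC.
have /le_integrable : mu.-integrable setT
    (fun x => C%:E * ((gauss1 h x)%:E + (x ^+ 2 * gauss1 h x)%:E))%E.
  apply: integrableZl => //; apply: integrableD => //.
    exact: integrable_gauss1.
  exact: integrable_sqr_gauss1.
apply => //.
  apply/measurable_EFinP; apply: measurable_funM => //.
  by apply: continuous_measurable_fun; exact: gauss1_continuous.
move=> x _; rewrite -EFinD -EFinM !abse_EFin lee_fin.
rewrite normrM_gauss1; apply: le_trans (ler_norm _).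
rewrite -[X in X + _]mul1r -mulrDl mulrA ler_wpM2r ?gauss1_ge0//.
Qed.

Lemma sin_phase_measurable (a c : R) : measurable_fun setT (fun x : R => sin (a * x + c)).
Proof.
by apply: continuous_measurable_fun; exact: continuous_sin_affine.
Qed.

Lemma cos_phase_measurable (a c : R) : measurable_fun setT (fun x : R => cos (a * x + c)).
Proof.
by apply: continuous_measurable_fun; exact: continuous_cos_affine.
Qed.

Lemma norm_le_1Dsqr x : `|x| <= 1 * (1 + x ^+ 2).
Proof. by rewrite mul1r -real_normK ?num_real//; have := sqr_ge0 (`|x| - 1); nra. Qed.

Lemma integrable_cos_gauss1 a c :
  mu.-integrable setT (fun x => (cos (a * x + c) * gauss1 h x)%:E).
Proof.
apply: (@integrable_gauss1M _ 1) => [|x]; first exact: cos_phase_measurable.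
by rewrite mul1r (le_trans (cos_max _))// lerDl sqr_ge0.
Qed.

Lemma integrable_xsin_gauss1 a c :
  mu.-integrable setT (fun x => (x * sin (a * x + c) * gauss1 h x)%:E).
Proof.
apply: (@integrable_gauss1M _ 1) => [|x].
  by apply: measurable_funM => //; exact: sin_phase_measurable.
apply: le_trans (norm_le_1Dsqr _); rewrite normrM -[leRHS]mulr1.
by rewrite ler_wpM2l// sin_max.
Qed.

Lemma is_derive_gauss1 x : is_derive x 1 (gauss1 h) (- (2 / h) * x * gauss1 h x).
Proof.
have d1 : is_derive x 1 (fun y : R => - y ^+ 2 / h) (- (2 / h) * x).
  apply: is_derive_eq; rewrite /GRing.scale/= ?scaler0 ?add0r ?expr1 ?mulr1.
  by rewrite /GRing.scale/=; ring.
have := @is_derive1_comp _ expR (fun y : R => - y ^+ 2 / h) x _ _ (is_derive_expR _) d1.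
move=> d2; rewrite /gauss1; apply: is_derive_eq.
by rewrite ?scaler0 ?addr0 /GRing.scale/=; ring.
Qed.

Lemma is_derive_linear a c x : is_derive x 1 (fun y : R => a * y + c) a.
Proof. by apply: is_derive_eq; rewrite /GRing.scale/= mulr1 addr0. Qed.

Lemma is_derive_sin_linear a c x :
  is_derive x 1 (fun y : R => sin (a * y + c)) (cos (a * x + c) * a).
Proof.
exact: (@is_derive1_comp _ sin (fun y => a * y + c) x _ _ (is_derive_sin _) (is_derive_linear a c x)).
Qed.

Lemma gauss1_le x : gauss1 h x * x ^+ 2 <= (Num.sqrt (pi * h))^-1 * h.
Proof.
rewrite /gauss1 -mulrA ler_wpM2l ?invr_ge0// mulNr expRN mulrC ler_pdivrMr ?expR_gt0//.
rewrite mulrC -ler_pdivrMr//; apply: le_trans (expR_ge1Dx _); by rewrite lerDr.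
Qed.

(** The derivative [k'] of sin (a x + c) times the density has integral 0 over the line, since [k]
    vanishes at infinity by [gauss1_le]; the two terms of [k'] give the two sides. *)
Lemma integral_by_parts_gauss1 a c :
  a * \int[mu]_x (cos (a * x + c) * gauss1 h x) =
  2 / h * \int[mu]_x (x * sin (a * x + c) * gauss1 h x).
Proof.
pose k x := sin (a * x + c) * gauss1 h x.
pose k' x := a * (cos (a * x + c) * gauss1 h x) - 2 / h * (x * sin (a * x + c) * gauss1 h x).
have dk x : is_derive x 1 k (k' x).
  have d1 := is_derive_sin_linear a c x; have d2 := is_derive_gauss1 x.
  by rewrite /k; apply: is_derive_eq; rewrite /k' /GRing.scale/=; ring.
have ck : continuous k.
  move=> x; apply/differentiable_continuous/derivable1_diffP; exact: (@ex_derive _ _ _ _ _ _ _ (dk x)).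
have cg := gauss1_continuous h0.
have ccos := @continuous_cos_affine R a c.
have csin := @continuous_sin_affine R a c.
have ck' : continuous k'.
  move=> x; apply: cvgB; (apply: cvgM; first exact: cvg_cst); apply: cvgM; try exact: cg.
    exact: ccos.
  by apply: cvgM; [exact: cvg_id|exact: csin].
have i1 := integrableZl measurableT a (integrable_cos_gauss1 a c).
have i2 := integrableZl measurableT (2 / h) (integrable_xsin_gauss1 a c).
have ik' : mu.-integrable setT (EFin \o k').
  by apply: eq_integrable (integrableB measurableT i1 i2) => // x _; rewrite /k' /= -!EFinM -EFinB.
have intk' : \int[mu]_x k' x = a * \int[mu]_x (cos (a * x + c) * gauss1 h x) -
    2 / h * \int[mu]_x (x * sin (a * x + c) * gauss1 h x).
  rewrite RintegralB//.
  rewrite RintegralZl//; last exact: integrable_cos_gauss1.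
  by rewrite RintegralZl//; exact: integrable_xsin_gauss1.
apply/eqP; rewrite -subr_eq0 -intk'; apply/eqP.
(* Half-width n + 1 avoids the degenerate interval. The integrals converge to the full integral by
   domination, while the boundary values tend to 0. *)
have FTC n : (\int[mu]_(x in `[(- n.+1%:R)%R, (n.+1%:R)%R]) (k' x)%:E =
    (k (n.+1%:R)%R)%:E - (k (- n.+1%:R)%R)%:E)%E.
  apply: (@continuous_FTC2 _ k' k).
  - by rewrite -subr_gt0 opprK addr_gt0.
  - exact: continuous_subspaceT.
  - by split; [move=> x _; exact: (@ex_derive _ _ _ _ _ _ _ (dk x))
      |apply: cvg_at_right_filter; exact: ck|apply: cvg_at_left_filter; exact: ck].
  - by move=> x _; rewrite derive1E; exact: (@derive_val _ _ _ _ _ _ _ (dk x)).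
have lim1 : (\int[mu]_(x in `[(- n.+1%:R)%R, (n.+1%:R)%R]) (k' x)%:E)%E @[n --> \oo]
    --> (\int[mu]_x (k' x)%:E)%E.
  under eq_cvg do rewrite integral_mkcond.
  apply: (@dominated_cvg _ _ _ mu _ measurableT _ _ (fun x => `|k' x|%:E)) => //.
  - move=> n; apply/(measurable_restrictT _ _).1 => //.
    by apply/measurable_EFinP; apply: measurable_funTS; exact: continuous_measurable_fun.
  - move=> x _; apply: cvg_near_cst; near=> n.
    rewrite patchE mem_set//= in_itv/= -ler_norml.
    apply: (@le_trans _ _ n%:R); last by rewrite ler_nat.
    near: n; exact: nbhs_infty_ger.
  - by apply: eq_integrable (integrable_abse ik').
  - move=> n x _; rewrite patchE; case: ifP => _; first by rewrite abse_EFin.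
    by rewrite abse0 lee_fin.
have lim2 : ((k (n.+1%:R)%R)%:E - (k (- n.+1%:R)%R)%:E)%E @[n --> \oo] --> 0%E.
  under eq_cvg do rewrite -EFinB.
  apply: cvg_EFin; first by near=> n.
  pose K := (Num.sqrt (pi * h))^-1 * h.
  have kle (s : R) n : s ^+ 2 = n.+1%:R ^+ 2 -> `|k s| <= K * n.+1%:R^-1.
    move=> sn; rewrite normrM_gauss1.
    apply: (@le_trans _ _ (1 * gauss1 h s)); first by rewrite ler_wpM2r ?gauss1_ge0 ?sin_max.
    rewrite mul1r ler_pdivlMr//; apply: le_trans (gauss1_le s); rewrite sn.
    by rewrite ler_wpM2l ?gauss1_ge0// expr2 ler_pMr// ler1n.
  have hK : (2 * K * n.+1%:R^-1 : R) @[n --> \oo] --> 0.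
    by rewrite -[X in _ --> X](mulr0 (2 * K)); apply: cvgM; [exact: cvg_cst|exact: cvg_harmonic].
  apply/cvgr0Pnorm_le => e e0; have /cvgr0Pnorm_le/(_ e e0) := hK.
  apply: filterS => n; apply: le_trans; rewrite /=.
  apply: le_trans (ler_normB _ _) _; apply: le_trans (ler_norm _).
  rewrite -mulrA mulr_natl mulr2n; apply: lerD; apply: kle => //.
  by rewrite sqrrN.
rewrite /Rintegral (_ : (\int[mu]_x (k' x)%:E = 0)%E)//.
apply: (cvg_unique (@ereal_hausdorff R) lim1).
by rewrite (_ : (fun n : nat => _) = (fun n : nat => (k (n.+1%:R)%R)%:E - (k (- n.+1%:R)%R)%:E)%E)//; apply/funext.
Unshelve. all: by end_near. Qed.

(** Differentiation under the integral: |x| times the density dominates the partial derivative for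
    all [b]. *)
Lemma is_derive_fourier c a : is_derive a 1 (fun b : R => \int[mu]_x (cos (b * x + c) * gauss1 h x))
  (- \int[mu]_x (x * sin (a * x + c) * gauss1 h x)).
Proof.
pose f (b x : R) := cos (b * x + c) * gauss1 h x.
have df (b x : R) : is_derive b 1 (f ^~ x) (- (x * sin (b * x + c) * gauss1 h x)).
  have dl : is_derive b 1 (fun y : R => y * x + c) x.
    by apply: is_derive_eq; rewrite ?scaler0 /GRing.scale/= ?mulr1 ?add0r addr0.
  have := @is_derive1_comp _ cos (fun y => y * x + c) b _ _ (is_derive_cos _) dl.
  move=> d; rewrite /f; apply: is_derive_eq.
  by rewrite ?scaler0 ?add0r /GRing.scale/=; ring.
have aI : `]a - 1, a + 1[%classic a by rewrite /= in_itv/= ltrBlDr ltrDl ltr01.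
have p1 b x : partial1of2 f b x = - (x * sin (b * x + c) * gauss1 h x).
  by rewrite partial1of2E; exact: (@derive_val _ _ _ _ _ _ _ (df b x)).
pose G x := `|x| * gauss1 h x.
have G0 x : 0 <= G x by rewrite mulr_ge0 ?gauss1_ge0.
have iG : mu.-integrable setT (EFin \o G).
  apply: (@integrable_gauss1M (fun x => `|x|) 1) => [|x]; first by apply: continuous_measurable_fun => x; exact: norm_continuous.
  by rewrite normr_id norm_le_1Dsqr.
have if_ b : `]a - 1, a + 1[%classic b -> mu.-integrable setT (EFin \o f b).
  by move=> _; exact: integrable_cos_gauss1.
have df_ b x : `]a - 1, a + 1[%classic b -> setT x -> derivable (f ^~ x) b 1.
  by move=> _ _; exact: (@ex_derive _ _ _ _ _ _ _ (df b x)).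
have Gub b x : `]a - 1, a + 1[%classic b -> setT x -> `|partial1of2 f b x| <= G x.
  move=> _ _; rewrite p1 normrN normrM_gauss1 ler_wpM2r ?gauss1_ge0//.
  by rewrite normrM -[leRHS]mulr1 ler_wpM2l// sin_max.
apply: DeriveDef.
  exact: (derivable_under_integral measurableT aI if_ df_ G0 iG Gub).
rewrite -derive1E (differentiation_under_integral measurableT aI if_ df_ G0 iG Gub).
under eq_Rintegral do rewrite p1 -mulN1r.
by rewrite RintegralZl ?mulN1r//; exact: integrable_xsin_gauss1.
Qed.

(** The free phase [c] makes the formula iterate: in the plane, the contribution of the other
    coordinate is part of the phase. *)
Lemma fourier_gauss1 c a :
  \int[mu]_x (cos (a * x + c) * gauss1 h x) = expR (- (h * a ^+ 2 / 4)) * cos c.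
Proof.
pose F (b : R) := \int[mu]_x (cos (b * x + c) * gauss1 h x).
(* [F] solves F' = - (h / 2) b F, so [H] is constant. *)
pose H (b : R) := F b * expR (h * b ^+ 2 / 4).
have dH b : is_derive b 1 H 0.
  have d1 : is_derive b 1 F (- (h / 2 * b * F b)).
    have := is_derive_fourier c b; congr (is_derive _ _ _ (- _)).
    rewrite -[h / 2 * b * F b]mulrA integral_by_parts_gauss1 mulrA.
    by rewrite (_ : h / 2 * (2 / h) = 1) ?mul1r//; field; rewrite gt_eqF.
  have d2 : is_derive b 1 (fun y : R => h * y ^+ 2 / 4) (h / 2 * b).
    apply: is_derive_eq; rewrite ?scaler0 ?add0r ?addr0 /GRing.scale/= ?expr1.
    by field.
  have := @is_derive1_comp _ expR (fun y : R => h * y ^+ 2 / 4) b _ _ (is_derive_expR _) d2.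
  by move=> d3; rewrite /H; apply: is_derive_eq; rewrite /GRing.scale/=; ring.
have := is_derive_0_is_cst a 0 dH.
rewrite /H expr0n/= mulr0 mul0r expR0 mulr1 => Ha.
have F0 : F 0 = cos c.
  rewrite /F; under eq_Rintegral do rewrite mul0r add0r.
  by rewrite RintegralZl ?Rintegral_gauss1 ?mulr1//; exact: integrable_gauss1.
by rewrite -F0 -Ha expRN mulrC mulfK// gt_eqF ?expR_gt0.
Qed.

End Gaussian.

(** * The planar Gaussian *)

Section Gaussian2.
Variables (R : realType) (h : R).
Hypothesis h0 : 0 < h.
Local Notation mu := (@lebesgue_measure R).
Local Notation mu2 := (mu \x mu)%E.

Lemma integrable_prod (w : R -> R) : (forall x, 0 <= w x) ->
  mu.-integrable setT (EFin \o w) ->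
  mu2.-integrable setT (fun x : R * R => (w x.1 * w x.2)%:E).
Proof.
move=> w0 iw; have mw : measurable_fun setT w by apply/measurable_EFinP; exact: measurable_int iw.
apply/integrable12ltyP => /=.
  apply/measurable_EFinP/measurable_funM.
    by apply: measurableT_comp => //; exact: measurable_fst.
  by apply: measurableT_comp => //; exact: measurable_snd.
have fI : (\int[mu]_y (w y)%:E)%E \is a fin_num by exact: integrable_fin_num.
have inner x : (\int[mu]_y `|w x * w y|%:E = (w x)%:E * \int[mu]_y (w y)%:E)%E.
  under eq_integral do rewrite ger0_norm ?mulr_ge0// EFinM.
  exact: integralZl.
under eq_integral do rewrite inner muleC -(fineK fI).
by rewrite integralZl// -(fineK fI) -EFinM ltry.
Qed.

Lemma gauss2_ge0 (x : R * R) : 0 <= gauss2 h x.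
Proof. by rewrite [x]surjective_pairing gauss2E// mulr_ge0 ?gauss1_ge0. Qed.

Lemma normrM_gauss2 (u : R) (x : R * R) : `|u * gauss2 h x| = `|u| * gauss2 h x.
Proof. by rewrite normrM [X in _ * X]ger0_norm ?gauss2_ge0. Qed.

Lemma gauss2_measurable : measurable_fun setT (@gauss2 R h).
Proof.
rewrite (_ : gauss2 h = fun x : R * R => gauss1 h x.1 * gauss1 h x.2); last first.
  by apply/funext => x; rewrite [X in gauss2 _ X]surjective_pairing gauss2E.
have mg : measurable_fun setT (gauss1 h).
  by apply: continuous_measurable_fun; exact: gauss1_continuous.
by apply: measurable_funM; apply: measurableT_comp.
Qed.

(** The majorant 1 + x1^2 + x2^2 <= (1 + x1^2) (1 + x2^2) separates the variables. *)
Lemma integrable_gauss2M (u : R * R -> R) C : measurable_fun setT u ->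
  (forall x, `|u x| <= C * (1 + (x.1 ^+ 2 + x.2 ^+ 2))) ->
  mu2.-integrable setT (fun x => (u x * gauss2 h x)%:E).
Proof.
move=> mu_ uC; pose w (x : R) := (1 + x ^+ 2) * gauss1 h x.
have w0 x : 0 <= w x by rewrite mulr_ge0 ?gauss1_ge0// addr_ge0 ?sqr_ge0.
have iw : mu.-integrable setT (EFin \o w).
  apply: (@integrable_gauss1M _ _ h0 _ 1) => [|x].
    by apply: measurable_funD => //; exact: exprn_measurable.
  by rewrite mul1r ger0_norm// addr_ge0 ?sqr_ge0.
have /le_integrable : mu2.-integrable setT (fun x : R * R => C%:E * (w x.1 * w x.2)%:E)%E.
  by apply: integrableZl => //; exact: integrable_prod.
apply => //.
  by apply/measurable_EFinP; apply: measurable_funM => //; exact: gauss2_measurable.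
move=> x _; rewrite -EFinM !abse_EFin lee_fin normrM_gauss2.
apply: le_trans (ler_norm _).
rewrite [X in gauss2 _ X]surjective_pairing gauss2E//.
have -> : C * (w x.1 * w x.2) =
    C * ((1 + x.1 ^+ 2) * (1 + x.2 ^+ 2)) * (gauss1 h x.1 * gauss1 h x.2) by rewrite /w; ring.
apply: ler_wpM2r; first by rewrite mulr_ge0 ?gauss1_ge0.
apply: le_trans (uC x) _; apply: ler_wpM2l.
  have := le_trans (normr_ge0 _) (uC (0, 0)).
  by rewrite /= expr0n/= addr0 addr0 mulr1.
have -> : (1 + x.1 ^+ 2) * (1 + x.2 ^+ 2) = 1 + (x.1 ^+ 2 + x.2 ^+ 2) + x.1 ^+ 2 * x.2 ^+ 2 by ring.
by rewrite lerDl mulr_ge0 ?sqr_ge0.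
Qed.

Lemma linphase_measurable (th : R * R -> R) : linphase th ->
  measurable_fun setT (fun x => cos (th x)).
Proof.
move=> [a [b [c thE]]]; apply: measurableT_comp.
  by apply: continuous_measurable_fun; exact: continuous_cos.
rewrite (_ : th = fun x => a * x.1 + b * x.2 + c); last exact/funext.
apply: measurable_funD => //; apply: measurable_funD => //; exact: measurable_funM.
Qed.

Lemma trigpoly_measurable (p : R * R -> R) : trigpoly (@linphase R) p -> measurable_fun setT p.
Proof.
elim=> [a th /linphase_measurable mth|f g _ mf _ mg]; last exact: measurable_funD.
exact: measurable_funM.
Qed.

(** For the product sigma-algebra, [g] is a pointwise limit of trigonometric polynomials, which are
    built from the measurable coordinates; the growing error is harmless at a fixed point. *)
Lemma bounded_continuous_measurable (g : R * R -> R) : bounded_continuous g ->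
  measurable_fun setT g.
Proof.
move=> bg; have pP n := trigpoly_approx bg (@divr_gt0 R 1 n.+1%:R ltr01 (ltr0Sn _ _)).
have /choice[p pP'] : forall n : nat, exists q, trigpoly (@linphase R) q /\ forall x, `|g x - q x| <=
    1 / n.+1%:R * (1 + (x.1 ^+ 2 + x.2 ^+ 2)).
  by move=> n; have [q] := pP n; exists q.
apply: (@measurable_fun_cvg _ _ _ _ p) => [n|x _].
  by apply: trigpoly_measurable; have [] := pP' n.
apply/cvgrPdist_le => e e0.
have : (n.+1%:R^-1 * (1 + (x.1 ^+ 2 + x.2 ^+ 2)) : R) @[n --> \oo] --> 0.
  rewrite -[X in _ --> X](mul0r (1 + (x.1 ^+ 2 + x.2 ^+ 2))).
  by apply: cvgM; [exact: cvg_harmonic|exact: cvg_cst].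
move=> /cvgr0Pnorm_le/(_ e e0); apply: filterS => n; apply: le_trans.
by apply: le_trans (ler_norm _); have [_ /(_ x)] := pP' n; rewrite div1r.
Qed.

Lemma fourier_gauss2 (a b c : R) :
  int_R2 (fun x => cos (a * x.1 + b * x.2 + c) * gauss2 h x) =
  expR (- (h * (a ^+ 2 + b ^+ 2) / 4)) * cos c.
Proof.
have int1 : mu2.-integrable setT (fun x : R * R => (cos (a * x.1 + b * x.2 + c) * gauss2 h x)%:E).
  apply: (@integrable_gauss2M _ 1) => [|x].
    by apply: linphase_measurable; exists a, b, c.
  by rewrite mul1r (le_trans (cos_max _))// lerDl addr_ge0 ?sqr_ge0.
rewrite /int_R2 /Rintegral -integral12_prod_meas1//.
have inner x : fubini_F mu (fun x : R * R => (cos (a * x.1 + b * x.2 + c) * gauss2 h x)%:E) x =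
    ((expR (- (h * b ^+ 2 / 4)))%:E * (cos (a * x + c) * gauss1 h x)%:E)%E.
  rewrite /fubini_F/=.
  transitivity (\int[mu]_y ((gauss1 h x)%:E * (cos (b * y + (a * x + c)) * gauss1 h y)%:E))%E.
    apply: eq_integral => y _; rewrite gauss2E// -EFinM; congr (_%:E).
    by rewrite mulrCA; congr (_ * (cos _ * _)); ring.
  rewrite integralZl//; last exact: integrable_cos_gauss1.
  rewrite -[X in (_ * X)%E]fineK; last by apply: integrable_fin_num => //; exact: integrable_cos_gauss1.
  rewrite -/(Rintegral _ _ _) fourier_gauss1// -!EFinM; congr (_%:E); ring.
transitivity (fine (\int[mu]_x ((expR (- (h * b ^+ 2 / 4)))%:E * (cos (a * x + c) * gauss1 h x)%:E)%E)).
  by congr fine; apply: eq_integral => x _; exact: inner.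
rewrite integralZl//; last exact: integrable_cos_gauss1.
rewrite fineM//; last by apply: integrable_fin_num => //; exact: integrable_cos_gauss1.
rewrite -/(Rintegral _ _ _) fourier_gauss1//= mulrA -expRD; congr (expR _ * _).
by field.
Qed.

Lemma int_R2_gauss2_dist (g p : R * R -> R) (e : R) : 0 <= e -> bounded_continuous g ->
  trigpoly (@linphase R) p -> (forall x, `|g x - p x| <= e * (1 + (x.1 ^+ 2 + x.2 ^+ 2))) ->
  `|int_R2 (fun x => g x * gauss2 h x) - int_R2 (fun x => p x * gauss2 h x)| <=
  e * int_R2 (fun x => (1 + (x.1 ^+ 2 + x.2 ^+ 2)) * gauss2 h x).
Proof.
move=> e0 bg Pp gp; have mg := bounded_continuous_measurable bg; have mp := trigpoly_measurable Pp.
have q0 (x : R * R) : 1 <= 1 + (x.1 ^+ 2 + x.2 ^+ 2) by rewrite lerDl addr_ge0 ?sqr_ge0.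
have bdd (u : R * R -> R) M : 0 <= M -> (forall x, `|u x| <= M) ->
    forall x, `|u x| <= M * (1 + (x.1 ^+ 2 + x.2 ^+ 2)).
  by move=> M0 uM x; apply: le_trans (uM x) _; rewrite ler_peMr.
have [cg [M gM]] := bg; have M0 : 0 <= M := le_trans (normr_ge0 _) (gM (0, 0)).
have ig := integrable_gauss2M mg (bdd _ _ M0 gM).
have [M' M'0 pM] := trigpoly_bounded Pp.
have ip := integrable_gauss2M mp (bdd _ _ M'0 pM).
have mq : measurable_fun setT (fun x : R * R => 1 + (x.1 ^+ 2 + x.2 ^+ 2)).
  apply: measurable_funD => //; apply: measurable_funD; apply: measurable_funX.
    exact: measurable_fst.
  exact: measurable_snd.
have iq : mu2.-integrable setT (fun x : R * R => ((1 + (x.1 ^+ 2 + x.2 ^+ 2)) * gauss2 h x)%:E).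
  by apply: (@integrable_gauss2M _ 1) => // x; rewrite mul1r ger0_norm// (le_trans ler01).
rewrite /int_R2 -RintegralB//; apply: le_trans (le_normr_Rintegral _ _) _ => //.
  by apply: eq_integrable (integrableB measurableT ig ip).
rewrite -RintegralZl//; apply: le_Rintegral => //.
- apply: eq_integrable (integrable_abse (integrableB measurableT ig ip)) => //.
- exact: eq_integrable (integrableZl measurableT e iq).
move=> x _; rewrite -mulrBl normrM_gauss2 mulrA ler_wpM2r ?gauss2_ge0//.
Qed.

End Gaussian2.

(** * Characteristic functions of sums of modes *)

Section Taylor.
Variable R : realType.
Implicit Types (f df : R -> R) (u x : R).

(** By the mean value theorem a bound on the derivative gains one power. Iterated from |cos| <= 1,
    it yields all Taylor bounds below; factorials are dropped, as only the orders matter. *)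
Lemma norm_le_powS f df n : f 0 = 0 -> (forall x, is_derive x 1 f (df x)) ->
  (forall x, `|df x| <= `|x| ^+ n) -> forall u, `|f u| <= `|u| ^+ n.+1.
Proof.
move=> f0 fdf dfn u.
have cf : continuous f.
  by move=> x; apply/differentiable_continuous/derivable1_diffP; exact: (@ex_derive _ _ _ _ _ _ _ (fdf x)).
have bound (c : R) : `|c| <= `|u| -> `|df c * u| <= `|u| ^+ n.+1.
  move=> cu; rewrite normrM exprSr ler_wpM2r//; apply: le_trans (dfn c) _.
  by rewrite lerXn2r ?nnegrE.
have [u0|u0] := leP 0 u.
  have [c + fE] := @MVT_segment _ f df 0 u u0 (fun x _ => fdf x) (continuous_subspaceT cf).
  move: fE; rewrite f0 !subr0 in_itv/= => -> /andP[c0 cu].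
  by apply: bound; rewrite !ger0_norm.
have [c + fE] := @MVT_segment _ f df u 0 (ltW u0) (fun x _ => fdf x) (continuous_subspaceT cf).
rewrite in_itv/= => /andP[c0 cu]; move: fE; rewrite f0 !sub0r mulrN => /oppr_inj ->.
by apply: bound; rewrite !ler0_norm ?(ltW u0)// lerN2.
Qed.

Lemma norm_sin_le u : `|sin u| <= `|u|.
Proof.
rewrite -[leRHS]expr1; apply: (@norm_le_powS sin cos) => [|x]; first exact: sin0.
by rewrite expr0 cos_max.
Qed.

Lemma norm_1Bcos_le u : `|1 - cos u| <= `|u| ^+ 2.
Proof.
apply: (@norm_le_powS (fun x => 1 - cos x) sin) => [|x|x]; first by rewrite cos0 subrr.
  have d := is_derive_cos x; apply: is_derive_eq; rewrite ?sub0r ?add0r ?opprK ?mul1r//.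
by rewrite expr1 norm_sin_le.
Qed.

Lemma norm_sin_taylor u : `|u - sin u| <= `|u| ^+ 3.
Proof.
apply: (@norm_le_powS (fun x => x - sin x) (fun x => 1 - cos x)) => [|x].
- by rewrite sin0 subrr.
- exact: norm_1Bcos_le.
Qed.

Lemma norm_cos_taylor u : `|cos u - (1 - u ^+ 2 / 2)| <= `|u| ^+ 4.
Proof.
apply: (@norm_le_powS (fun x => cos x - (1 - x ^+ 2 / 2)) (fun x => x - sin x)) => [|x|x].
- by rewrite cos0 expr0n/= mul0r subr0 subrr.
- apply: is_derive_eq; rewrite ?scaler0 /GRing.scale/= ?expr1.
  by field.
- exact: norm_sin_taylor.
Qed.

(** The upper bound goes through e^{-x} <= 1 / (1 + x), with (1 - x + x^2) (1 + x) = 1 + x^3. *)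
Lemma expRN_taylor x : 0 <= x -> `|expR (- x) - (1 - x)| <= x ^+ 2.
Proof.
move=> x0; have e1 := expR_ge1Dx (- x).
rewrite ger0_norm ?subr_ge0// lerBlDr expRN.
have x1 : 0 < 1 + x by rewrite ltr_wpDr.
apply: (@le_trans _ _ (1 + x)^-1).
  by rewrite lef_pV2 ?posrE ?expR_gt0// expR_ge1Dx.
rewrite -[leLHS]mul1r ler_pdivrMr//.
have -> : (x ^+ 2 + (1 - x)) * (1 + x) = 1 + x ^+ 3 by ring.
by rewrite lerDl exprn_ge0.
Qed.

End Taylor.

(** * Means of a finite sum of independent modes *)

Section CharacteristicFunction.
Variables (R : realType) (n : nat) (E : nat -> R) (a : nat -> R) (xi1 xi2 : R).
Hypothesis indE : Q_lin_indep n E.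

(* Contribution of the mode [j] to the scalar product of (xi1, xi2) with W, whose
   second coordinate carries a minus sign. *)
Definition wave j (t : R) : R := xi1 * cos (t * E j) - xi2 * sin (t * E j).

Definition wave_sum A B (t : R) : R := \sum_(A <= j < B) a j * wave j t.

Let rho : R := xi1 ^+ 2 + xi2 ^+ 2.
Let r : R := `|xi1| + `|xi2|.

Lemma waveE j t : wave j t = xi1 * cos (E j * t + 0) + - xi2 * cos (E j * t + - (pi / 2)).
Proof. by rewrite /wave cosBpihalf addr0 mulrC mulNr [t * E j]mulrC [cos _ * _]mulrC. Qed.

Lemma wave_trigpoly (P : pred nat) j : (1 <= j <= n)%N -> P j ->
  trigpoly (phase (freq n E P)) (wave j).
Proof.
move=> jn Pj; apply: (eq_trigpoly (fun t => esym (waveE j t))).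
by apply: trigpolyD; apply: trigpoly_cos;
  [exists (E j), 0|exists (E j), (- (pi / 2))]; split=> //; exact: freq_gen.
Qed.

Lemma freq_neq0 j : (1 <= j <= n)%N -> E j != 0.
Proof.
move=> jn; apply/eqP => Ej0.
have sum0 : \sum_(1 <= k < n.+1) ratr (k == j)%:R * E k = 0.
  rewrite (bigD1_seq j)/= ?iota_uniq ?mem_index_iota ?ltnS//= Ej0 mulr0 add0r.
  by rewrite big1// => k /negbTE ->; rewrite rmorph0 mul0r.
by have /eqP := indE (c := fun k => (k == j)%:R) sum0 jn; rewrite eqxx oner_eq0.
Qed.

Lemma wave_mean j : (1 <= j <= n)%N -> time_avg_cvg (wave j) 0.
Proof.
move=> jn; have Ej := freq_neq0 jn.
rewrite (_ : wave j = (fun t => xi1 * cos (E j * t + 0) + - xi2 * cos (E j * t + - (pi / 2)))); last first.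
  by apply/funext => t; exact: waveE.
have m0 : xi1 * ((E j == 0)%:R * cos 0) + - xi2 * ((E j == 0)%:R * cos (- (pi / 2))) = 0.
  by rewrite (negbTE Ej) !mul0r !mulr0 addr0.
have c1 b ph : continuous (fun t : R => b * cos (E j * t + ph)).
  by apply: (@trigpoly_continuous _ setT); apply: trigpoly_cos; exists (E j), ph.
rewrite -[X in time_avg_cvg _ X]m0.
apply: (@time_avgD _ (fun t => xi1 * cos (E j * t + 0)) (fun t => - xi2 * cos (E j * t + - (pi / 2)))) => //;
  exact: time_avg_cos_amp.
Qed.

(** By the double angle formulas the square is [rho / 2] plus oscillations of frequency [2 * E j],
    nonzero by independence. *)
Lemma wave_sqr_mean j : (1 <= j <= n)%N ->
  time_avg_cvg (fun t => wave j t ^+ 2) (rho / 2).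
Proof.
move=> jn; have Ej : 2 * E j != 0 by rewrite mulf_neq0// freq_neq0.
pose g1 (t : R) := (xi1 ^+ 2 - xi2 ^+ 2) / 2 * cos ((2 * E j) * t + 0).
pose g2 (t : R) := - (xi1 * xi2) * cos ((2 * E j) * t + - (pi / 2)).
have -> : (fun t => wave j t ^+ 2) = (fun t => rho / 2 + (g1 t + g2 t)).
  apply/funext => t; rewrite /g1 /g2 cosBpihalf addr0 /wave /rho.
  have -> : 2 * E j * t = (t * E j) *+ 2 by rewrite -mulr_natl; ring.
  rewrite cos_mulr2n sin_mulr2n.
  have := cos2Dsin2 (t * E j); set c := cos _; set s := sin _ => cs.
  have -> : (xi1 * c - xi2 * s) ^+ 2 = xi1 ^+ 2 * c ^+ 2 + xi2 ^+ 2 * (c ^+ 2 + s ^+ 2 - c ^+ 2) - 2 * xi1 * xi2 * (c * s) by ring.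
  by rewrite cs; field.
have c1 b w ph : continuous (fun t : R => b * cos (w * t + ph)).
  by apply: (@trigpoly_continuous _ setT); apply: trigpoly_cos; exists w, ph.
have mE : rho / 2 + ((xi1 ^+ 2 - xi2 ^+ 2) / 2 * ((2 * E j == 0)%:R * cos 0) +
    - (xi1 * xi2) * ((2 * E j == 0)%:R * cos (- (pi / 2)))) = rho / 2.
  by rewrite (negbTE Ej) !mul0r !mulr0 !addr0.
rewrite -[X in time_avg_cvg _ X]mE.
apply: (@time_avgD _ (fun=> rho / 2) (fun t => g1 t + g2 t)).
- by move=> t; exact: cvg_cst.
- by move=> t; apply: cvgD; exact: c1.
- exact: time_avg_cst.
- by apply: time_avgD => //; try exact: c1; exact: time_avg_cos_amp.
Qed.

Lemma norm_wave_le j t : `|wave j t| <= r.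
Proof.
apply: le_trans (ler_normB _ _) _; rewrite !normrM.
by apply: lerD; apply: ler_piMr => //; [exact: cos_max|exact: sin_max].
Qed.

Lemma wave_sum_trigpoly (P : pred nat) A B : (1 <= A)%N -> (B <= n.+1)%N ->
  (forall j, (A <= j < B)%N -> P j) -> trigpoly (phase (freq n E P)) (wave_sum A B).
Proof.
move=> A1 Bn AP.
rewrite (_ : wave_sum A B = fun t => \sum_(j <- index_iota A B | (A <= j < B)%N) a j * wave j t); last first.
  by apply/funext => t; rewrite /wave_sum big_nat.
apply: trigpoly_sum => [|j /[dup] /AP Pj /andP[Aj jB]]; first exact: phase0 (freq_additive _ _ _).
apply: trigpolyZ; apply: wave_trigpoly => //.
by rewrite (leq_trans A1 Aj)/= -ltnS (leq_trans jB).
Qed.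

Lemma indep_next A k : indep_freq (freq n E (fun j => A <= j < A + k)%N)
  (freq n E (fun j => A + k <= j < (A + k).+1)%N).
Proof.
by apply: freq_indep => // j /andP[_ jk]; rewrite negb_and -ltnNge jk.
Qed.

Lemma bounded_continuous_cos_fst (ph : R) : bounded_continuous (fun x : R * R => cos (x.1 + ph)).
Proof.
split; last by exists 1 => x; exact: cos_max.
move=> x; apply: (@continuous_comp _ _ _ (fun x : R * R => x.1 + ph) cos); last exact: continuous_cos.
by apply: cvgD; [exact: cvg_fst|exact: cvg_cst].
Qed.

Lemma almost_periodic_cos (F : R -> Prop) (f : R -> R) (ph : R) : additive_freq F ->
  trigpoly (phase F) f -> almost_periodic F (fun t => cos (f t + ph)).
Proof.
move=> aF Pf; exact: (almost_periodic_comp aF (bounded_continuous_cos_fst ph) Pf Pf).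
Qed.

Lemma wave_sumS A k t :
  wave_sum A (A + k.+1) t = wave_sum A (A + k) t + a (A + k)%N * wave (A + k)%N t.
Proof. by rewrite addnS /wave_sum big_nat_recr// leq_addr. Qed.

(** Modes are uncorrelated: the cross term with a new mode has mean a product of two zero means. The
    zero mean of the partial sum is therefore proved in the same induction. *)
Lemma wave_sum_mean A k : (1 <= A)%N -> (A + k <= n.+1)%N ->
  time_avg_cvg (wave_sum A (A + k)) 0 /\
  time_avg_cvg (fun t => wave_sum A (A + k) t ^+ 2) (rho / 2 * \sum_(A <= j < A + k) a j ^+ 2).
Proof.
move=> A1; elim: k => [_|k IHk].
  rewrite addn0 big_geq// mulr0; split.
    by rewrite (_ : wave_sum A A = fun=> 0); [exact: time_avg_cst|apply/funext => t; rewrite /wave_sum big_geq].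
  rewrite (_ : (fun t => wave_sum A A t ^+ 2) = fun=> 0); first exact: time_avg_cst.
  by apply/funext => t; rewrite /wave_sum big_geq// expr0n.
rewrite addnS ltnS => kn; have [IH1 IH2] := IHk (leqW kn).
have kn1 : (1 <= A + k <= n)%N by rewrite (leq_trans A1 (leq_addr _ _)).
have PS := @wave_sum_trigpoly (fun j => A <= j < A + k)%N A (A + k) A1 (leqW kn) (fun _ => id).
have Pv : trigpoly (phase (freq n E (fun j => A + k <= j < (A + k).+1)%N)) (wave (A + k)).
  by apply: wave_trigpoly => //; rewrite leqnn ltnSn.
have cS := trigpoly_continuous PS; have cv := trigpoly_continuous Pv.
have SE : wave_sum A (A + k).+1 = (fun t => wave_sum A (A + k) t + a (A + k)%N * wave (A + k)%N t).
  by apply/funext => t; rewrite -addnS wave_sumS.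
have cav : continuous (fun t => a (A + k)%N * wave (A + k) t).
  by move=> t; apply: cvgM; [exact: cvg_cst|exact: cv].
rewrite SE; split.
  rewrite -[X in time_avg_cvg _ X](addr0 0) -[X in time_avg_cvg _ (_ + X)](mulr0 (a (A + k)%N)).
  apply: time_avgD => //; apply: time_avgZ => //; exact: wave_mean.
rewrite big_nat_recr ?leq_addr//= mulrDr.
have -> : (fun t => (wave_sum A (A + k) t + a (A + k)%N * wave (A + k) t) ^+ 2) =
    (fun t => wave_sum A (A + k) t ^+ 2 +
      (2 * a (A + k)%N * (wave_sum A (A + k) t * wave (A + k) t) + a (A + k)%N ^+ 2 * wave (A + k) t ^+ 2)).
  by apply/funext => t; ring.
have cS2 : continuous (fun t => wave_sum A (A + k) t ^+ 2) by exact: continuousMfun.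
have cv2 : continuous (fun t => wave (A + k) t ^+ 2) by exact: continuousMfun.
have cSv : continuous (fun t => wave_sum A (A + k) t * wave (A + k) t) by exact: continuousMfun.
have mSv := trigpoly_mean_indep (@indep_next A k) PS Pv IH1 (wave_mean kn1).
rewrite mulr0 in mSv.
have ccst (c : R) : continuous (fun _ : R => c) by move=> ?; exact: cvg_cst.
have -> : rho / 2 * a (A + k)%N ^+ 2 = 2 * a (A + k)%N * 0 + a (A + k)%N ^+ 2 * (rho / 2).
  by rewrite mulr0 add0r mulrC.
apply: time_avgD => //.
  move=> t; apply: cvgD; apply: cvgM; try exact: cvg_cst; [exact: cSv|exact: cv2].
apply: time_avgD; [exact: (continuousMfun (ccst _) cSv)|exact: (continuousMfun (ccst _) cv2)|exact: time_avgZ|].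
by apply: time_avgZ => //; exact: wave_sqr_mean.
Qed.

Lemma norm_mean_le1 (f : R -> R) m : continuous f -> (forall t, `|f t| <= 1) ->
  time_avg_cvg f m -> `|m| <= 1.
Proof.
move=> cf f1 fm; rewrite -[m]subr0.
apply: (@time_avg_dist _ f (fun=> 0)) => // [?||t]; [exact: cvg_cst|exact: time_avg_cst|by rewrite subr0].
Qed.

(** Taylor expansion followed by averaging: the cosine keeps its quadratic term, with mean
    [rho / 2], whereas the linear term of the sine averages to 0 and leaves a cubic error. *)
Lemma cos_sin_wave_mean j (b : R) : (1 <= j <= n)%N -> exists c s,
  [/\ time_avg_cvg (fun t => cos (b * wave j t + 0)) c,
      time_avg_cvg (fun t => cos (b * wave j t + - (pi / 2))) s,
      `|c - (1 - b ^+ 2 * (rho / 4))| <= r ^+ 4 * b ^+ 4 & `|s| <= r ^+ 3 * `|b| ^+ 3].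
Proof.
move=> jn; have Pv := @wave_trigpoly predT j jn isT.
have Pbv := trigpolyZ b Pv.
have aF := freq_additive n E predT.
have APc := almost_periodic_cos 0 aF Pbv; have APs := almost_periodic_cos (- (pi / 2)) aF Pbv.
have [c cP] := almost_periodic_mean APc; have [s sP] := almost_periodic_mean APs.
have cv := trigpoly_continuous Pv; have cbv := trigpoly_continuous Pbv.
have bvr t : `|b * wave j t| <= `|b| * r by rewrite normrM ler_wpM2l// norm_wave_le.
exists c, s; split=> //.
  have cv2 : continuous (fun t => wave j t ^+ 2) by exact: continuousMfun.
  have cbv2 : continuous (fun t => - (b ^+ 2 / 2) * wave j t ^+ 2).
    by move=> t; apply: cvgM; [exact: cvg_cst|exact: cv2].
  have ccst : continuous (fun _ : R => 1 : R) by move=> ?; exact: cvg_cst.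
  have -> : 1 - b ^+ 2 * (rho / 4) = 1 + - (b ^+ 2 / 2) * (rho / 2) by field.
  apply: (@time_avg_dist _ (fun t => cos (b * wave j t + 0)) (fun t => 1 + - (b ^+ 2 / 2) * wave j t ^+ 2)) => //.
  - exact: APc.1.
  - by move=> t; apply: cvgD; [exact: ccst|exact: cbv2].
  - apply: time_avgD => //; first exact: time_avg_cst.
    by apply: time_avgZ => //; exact: wave_sqr_mean.
  - move=> t; rewrite addr0.
    have -> : 1 + - (b ^+ 2 / 2) * wave j t ^+ 2 = 1 - (b * wave j t) ^+ 2 / 2 by field.
    apply: le_trans (norm_cos_taylor _) _.
    have -> : r ^+ 4 * b ^+ 4 = (`|b| * r) ^+ 4.
      by rewrite exprMn mulrC; congr (_ * _); rewrite -[4%N]/(2 * 2)%N !exprM real_normK ?num_real.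
    by rewrite lerXn2r ?nnegrE// (le_trans _ (bvr t)).
rewrite -[s]subr0 -[X in s - X](mulr0 b).
apply: (@time_avg_dist _ (fun t => cos (b * wave j t + - (pi / 2))) (fun t => b * wave j t)) => //.
- exact: APs.1.
- by apply: time_avgZ => //; exact: wave_mean.
- move=> t; rewrite cosBpihalf distrC; apply: le_trans (norm_sin_taylor _) _.
  have rb : `|b * wave j t| <= r * `|b| by rewrite [r * _]mulrC.
  by rewrite -exprMn lerXn2r ?nnegrE// (le_trans _ rb).
Qed.

(* Adding an independent mode of amplitude b multiplies the mean of the cosine by
   exp (- rho b^2 / 4) up to an error O(|b|^3) = O(dl b^2). *)
Lemma charfn_wave_sum A k (dl ph : R) : (1 <= A)%N -> (A + k <= n.+1)%N ->
  0 <= dl <= 1 -> (forall j, (A <= j < A + k)%N -> `|a j| <= dl) ->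
  exists2 m, time_avg_cvg (fun t => cos (wave_sum A (A + k) t + ph)) m &
    `|m - expR (- (rho / 4 * \sum_(A <= j < A + k) a j ^+ 2)) * cos ph| <=
    (2 * r ^+ 4 + r ^+ 3) * dl * \sum_(A <= j < A + k) a j ^+ 2.
Proof.
move=> A1 + /andP[dl0 dl1]; elim: k ph => [|k IHk] ph.
  move=> _ _; exists (cos ph).
    rewrite addn0 (_ : (fun t => _) = fun=> cos ph); first exact: time_avg_cst.
    by apply/funext => t; rewrite /wave_sum big_geq// add0r.
  by rewrite addn0 big_geq// !mulr0 oppr0 expR0 mul1r subrr normr0.
rewrite addnS ltnS => kn adl.
have adlk j : (A <= j < A + k)%N -> `|a j| <= dl.
  by move=> /andP[Aj jk]; apply: adl; rewrite Aj ltnW.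
(* The addition formula for the new mode involves a cosine and a sine of the old sum, hence two
   phases and an induction over all [ph]. Of the sine part only the existence of the mean is
   retained. *)
have [m1 m1P m1E] := IHk ph (leqW kn) adlk; have [m2 m2P _] := IHk (ph + - (pi / 2)) (leqW kn) adlk.
have kn1 : (1 <= A + k <= n)%N by rewrite (leq_trans A1 (leq_addr _ _)).
have [c [s [cP sP cE sE]]] := cos_sin_wave_mean (a (A + k)%N) kn1.
have PS := @wave_sum_trigpoly (fun j => A <= j < A + k)%N A (A + k) A1 (leqW kn) (fun _ => id).
have Pv : trigpoly (phase (freq n E (fun j => A + k <= j < (A + k).+1)%N)) (fun t => a (A + k)%N * wave (A + k) t).
  by apply: trigpolyZ; apply: wave_trigpoly => //; rewrite leqnn ltnSn.
have aF P := freq_additive n E P.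
have AP1 := almost_periodic_cos ph (aF _) PS.
have AP2 := almost_periodic_cos (ph + - (pi / 2)) (aF _) PS.
have APc := almost_periodic_cos 0 (aF _) Pv; have APs := almost_periodic_cos (- (pi / 2)) (aF _) Pv.
have M1 := almost_periodic_mean_indep (@indep_next A k) AP1 APc m1P cP.
have M2 := almost_periodic_mean_indep (@indep_next A k) AP2 APs m2P sP.
have cM1 := continuousMfun AP1.1 APc.1; have cM2 := continuousMfun AP2.1 APs.1.
exists (m1 * c + -1 * (m2 * s)).
  rewrite (_ : (fun t => _) = (fun t => (cos (wave_sum A (A + k) t + ph) * cos (a (A + k)%N * wave (A + k) t + 0)) +
    -1 * (cos (wave_sum A (A + k) t + (ph + - (pi / 2))) * cos (a (A + k)%N * wave (A + k) t + - (pi / 2))))); last first.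
    apply/funext => t; rewrite -addnS wave_sumS addr0 [_ + (ph + _)]addrA !cosBpihalf mulN1r -cosD.
    by congr cos; ring.
  apply: time_avgD => //; last exact: time_avgZ.
  by move=> t; apply: cvgM; [exact: cvg_cst|exact: cM2].
rewrite big_nat_recr ?leq_addr//=.
have := adl (A + k)%N; rewrite leq_addr ltnSn => /(_ isT).
set b := a (A + k)%N; set S := \sum_(_ <= _ < _) _ => bdl.
have S0 : 0 <= S by apply: sumr_ge0 => j _; exact: sqr_ge0.
have r0 : 0 <= r by rewrite addr_ge0.
have rho0 : 0 <= rho by rewrite addr_ge0 ?sqr_ge0.
have rhor : rho <= r ^+ 2.
  rewrite /rho /r -(@real_normK _ xi1) ?num_real// -(@real_normK _ xi2) ?num_real//.
  by rewrite sqrrD addrAC lerDl mulrn_wge0// mulr_ge0.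
pose q := expR (- (rho / 4 * b ^+ 2)).
have q01 : `|q| <= 1.
  by rewrite ger0_norm ?expR_ge0// -expR0 ler_expR oppr_le0 mulr_ge0 ?sqr_ge0// divr_ge0.
have m11 : `|m1| <= 1 by apply: norm_mean_le1 m1P => [|t]; [exact: AP1.1|exact: cos_max].
have m21 : `|m2| <= 1 by apply: norm_mean_le1 m2P => [|t]; [exact: AP2.1|exact: cos_max].
(* One r^4 b^4 comes from the cosine expansion and one from that of the exponential, through rho <=
   r^2. *)
have cq : `|c - q| <= 2 * r ^+ 4 * b ^+ 4.
  have -> : c - q = (c - (1 - b ^+ 2 * (rho / 4))) - (q - (1 - rho / 4 * b ^+ 2)) by rewrite /q; ring.
  apply: le_trans (ler_normB _ _) _.
  have -> : 2 * r ^+ 4 * b ^+ 4 = r ^+ 4 * b ^+ 4 + r ^+ 4 * b ^+ 4 by ring.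
  apply: lerD => //; apply: le_trans (expRN_taylor _) _; first by rewrite mulr_ge0 ?sqr_ge0// divr_ge0.
  rewrite exprMn -exprM ler_wpM2r// ?exprn_even_ge0//.
  rewrite (_ : r ^+ 4 = (r ^+ 2) ^+ 2); last by rewrite -exprM.
  rewrite lerXn2r ?nnegrE ?sqr_ge0 ?mulr_ge0//; apply: le_trans rhor.
  by rewrite ler_piMr// invf_le1// ler1n.
have b4 : b ^+ 4 <= dl * b ^+ 2.
  have -> : b ^+ 4 = `|b| ^+ 2 * b ^+ 2 by rewrite real_normK ?num_real// -exprD.
  rewrite ler_wpM2r ?sqr_ge0//; apply: (@le_trans _ _ (`|b| * 1)); last by rewrite mulr1.
  by rewrite expr2 ler_wpM2l// (le_trans bdl).
have b3 : `|b| ^+ 3 <= dl * b ^+ 2.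
  by rewrite exprS real_normK ?num_real// ler_wpM2r ?sqr_ge0.
rewrite mulrDr opprD expRD -/q.
(* As [m1], [q] and [m2] have modulus at most 1, the old error is not amplified and each mode adds
   only its own. *)
have -> : m1 * c + -1 * (m2 * s) - expR (- (rho / 4 * S)) * q * cos ph =
   m1 * (c - q) + q * (m1 - expR (- (rho / 4 * S)) * cos ph) - m2 * s by ring.
apply: le_trans (ler_normB _ _) _.
have -> : (2 * r ^+ 4 + r ^+ 3) * dl * (S + b ^+ 2) =
  2 * r ^+ 4 * (dl * b ^+ 2) + (2 * r ^+ 4 + r ^+ 3) * dl * S + r ^+ 3 * (dl * b ^+ 2) by ring.
apply: lerD.
  apply: le_trans (ler_normD _ _) _; rewrite !normrM; apply: lerD.
    rewrite -[leRHS]mul1r; apply: ler_pM => //; apply: le_trans cq _.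
    by rewrite ler_wpM2l// mulr_ge0// exprn_ge0.
  by rewrite -[leRHS]mul1r; apply: ler_pM.
rewrite normrM -[leRHS]mul1r; apply: ler_pM => //; apply: le_trans sE _.
by rewrite ler_wpM2l// exprn_ge0.
Qed.

End CharacteristicFunction.

(** * Increments of the process *)

Lemma trigpoly_linphase_continuous (R : realType) (p : R * R -> R) :
  trigpoly (@linphase R) p -> continuous p.
Proof.
elim=> [a th [x1 [x2 [c thE]]]|f g _ cf _ cg] x; last by apply: cvgD; [exact: cf|exact: cg].
apply: cvgM; first exact: cvg_cst.
rewrite (_ : th = fun x => x1 * x.1 + x2 * x.2 + c); last exact/funext.
apply: (@continuous_comp _ _ _ (fun x : R * R => x1 * x.1 + x2 * x.2 + c) cos); last exact: continuous_cos.
apply: cvgD; last exact: cvg_cst.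
by apply: cvgD; (apply: cvgM; first exact: cvg_cst); [exact: cvg_fst|exact: cvg_snd].
Qed.

Section Increments.
Variables (R : realType) (E d : nat -> nat -> R).
Implicit Types (s h e t : R) (N : nat).

Definition amp N j : R := (DeltaZ d N)^-1 * d N j.

Lemma fl_mono N s s' : s <= s' -> (fl N s <= fl N s')%N.
Proof. by move=> ss'; apply: le_truncn; rewrite ler_wpM2l. Qed.

(** When [DeltaZ2 d N] is 0, as for [N = 0], both sides are 0 because the inverse of 0 is 0. *)
Lemma amp_sqr N j : amp N j ^+ 2 = d N j ^+ 2 / DeltaZ2 d N.
Proof.
have Z0 : 0 <= DeltaZ2 d N by apply: sumr_ge0 => k _; exact: sqr_ge0.
by rewrite /amp exprMn exprVn /DeltaZ (sqr_sqrtr Z0) mulrC.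
Qed.

Lemma sum_amp_sqr N s h :
  \sum_((fl N s).+1 <= j < (fl N (s + h)).+1) amp N j ^+ 2 = R1 d N h s.
Proof. by rewrite /R1 mulr_suml; apply: eq_bigr => j _; exact: amp_sqr. Qed.

Lemma Wincr1E N s s' t : s <= s' -> (Wincr E d N s s' t).1 =
  wave_sum (E N) (amp N) 1 0 (fl N s).+1 (fl N s').+1 t.
Proof.
move=> ss'; have ff := fl_mono N ss'.
rewrite /Wincr /W /wave_sum /=.
rewrite (@big_cat_nat _ _ _ (fl N s).+1 1%N (fl N s').+1)//= mulrDr addrC addKr mulr_sumr.
by apply: eq_bigr => j _; rewrite /wave /amp mul1r mul0r subr0 mulrA.
Qed.

Lemma Wincr2E N s s' t : s <= s' -> (Wincr E d N s s' t).2 =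
  wave_sum (E N) (amp N) 0 1 (fl N s).+1 (fl N s').+1 t.
Proof.
move=> ss'; have ff := fl_mono N ss'.
rewrite /Wincr /W /wave_sum /= opprK.
rewrite (@big_cat_nat _ _ _ (fl N s).+1 1%N (fl N s').+1)//= mulrDr opprD addrAC addNr add0r mulr_sumr.
by rewrite -sumrN; apply: eq_bigr => j _; rewrite /wave /amp mul1r mul0r sub0r mulrN mulrA.
Qed.

Lemma Wincr_lin N s s' t (x1 x2 : R) : s <= s' ->
  x1 * (Wincr E d N s s' t).1 + x2 * (Wincr E d N s s' t).2 =
  wave_sum (E N) (amp N) x1 x2 (fl N s).+1 (fl N s').+1 t.
Proof.
move=> ss'; rewrite Wincr1E// Wincr2E// /wave_sum !mulr_sumr -big_split/=.
by apply: eq_bigr => j _; rewrite /wave; ring.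
Qed.

Lemma WincrE N s s' t : s <= s' -> Wincr E d N s s' t =
  (wave_sum (E N) (amp N) 1 0 (fl N s).+1 (fl N s').+1 t,
   wave_sum (E N) (amp N) 0 1 (fl N s).+1 (fl N s').+1 t).
Proof. by move=> ss'; rewrite [LHS]surjective_pairing Wincr1E// Wincr2E. Qed.

Lemma almost_periodic_Wincr n N s s' (g : R * R -> R) (P : pred nat) : s <= s' ->
  (fl N s' <= n)%N -> bounded_continuous g ->
  (forall j, (fl N s < j <= fl N s')%N -> P j) ->
  almost_periodic (freq n (E N) P) (fun t => g (Wincr E d N s s' t)).
Proof.
move=> ss' sn bg FP; under [X in almost_periodic _ X]funext do rewrite WincrE//.
by apply: almost_periodic_comp => //; [exact: freq_additive|exact: wave_sum_trigpoly..].
Qed.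

(** Increments over successive intervals use disjoint blocks of modes. The partial products are
    carried as almost periodic functions on the modes used so far, since the next factorization
    needs this besides their means. *)
Lemma Wincr_indep n N m (sv : nat -> R) (g : nat -> R * R -> R) :
  Q_lin_indep n (E N) -> (fl N (sv m) <= n)%N ->
  (forall i, (i < m)%N -> sv i <= sv i.+1) ->
  (forall i, (1 <= i <= m)%N -> bounded_continuous (g i)) ->
  exists l : nat -> R,
    (forall i, (1 <= i <= m)%N ->
       time_avg_cvg (fun t => g i (Wincr E d N (sv i.-1) (sv i) t)) (l i)) /\
    time_avg_cvg (fun t => \prod_(1 <= i < m.+1) g i (Wincr E d N (sv i.-1) (sv i) t))
      (\prod_(1 <= i < m.+1) l i).
Proof.
move=> indE mn svS bg.
have sv_le i k : (i + k <= m)%N -> sv i <= sv (i + k)%N.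
  elim: k => [|k IHk]; first by rewrite addn0.
  by rewrite addnS => ikm; apply: le_trans (IHk (ltnW ikm)) (svS _ ikm).
have fln i : (i <= m)%N -> (fl N (sv i) <= n)%N.
  move=> im; apply: leq_trans mn; apply: fl_mono.
  by rewrite -(subnKC im); apply: sv_le; rewrite subnKC.
pose f i t := g i (Wincr E d N (sv i.-1) (sv i) t).
have AP i : (1 <= i <= m)%N ->
    almost_periodic (freq n (E N) (fun j => fl N (sv i.-1) < j <= fl N (sv i))%N) (f i).
  case: i => // i /= im; apply: almost_periodic_Wincr; [exact: svS|exact: fln|exact: bg|by []].
have /choice[l lP] : forall i, exists l, (1 <= i <= m)%N -> time_avg_cvg (f i) l.
  move=> i; case im : (1 <= i <= m)%N; last by exists 0.
  by have [l] := almost_periodic_mean (AP i im); exists l.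
exists l; split=> //.
suff : forall k, (k <= m)%N ->
    almost_periodic (freq n (E N) (fun j => j <= fl N (sv k))%N) (fun t => \prod_(1 <= i < k.+1) f i t) /\
    time_avg_cvg (fun t => \prod_(1 <= i < k.+1) f i t) (\prod_(1 <= i < k.+1) l i).
  by move=> /(_ m (leqnn m))[].
elim=> [_|k IHk km].
  rewrite big_geq// (_ : (fun t => _) = fun=> 1); last by apply/funext => t; rewrite big_geq.
  split; last exact: time_avg_cst.
  apply: trigpoly_almost_periodic; apply: trigpoly_cst; exact: phase0 (freq_additive _ _ _).
have [APk lk] := IHk (ltnW km).
have APk1 := AP k.+1 km.
rewrite big_nat_recr//= (_ : (fun t => _) = (fun t => (\prod_(1 <= i < k.+1) f i t) * f k.+1 t)); last first.
  by apply/funext => t; rewrite big_nat_recr.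
split.
  apply: almost_periodicM; first exact: freq_additive.
    apply: sub_almost_periodic APk => w; apply: sub_freq => j jk.
    exact: leq_trans jk (fl_mono _ (svS _ km)).
  by apply: sub_almost_periodic APk1 => w; apply: sub_freq => j /andP[].
have FG : indep_freq (freq n (E N) (fun j => j <= fl N (sv k))%N)
    (freq n (E N) (fun j => fl N (sv k.+1.-1) < j <= fl N (sv k.+1))%N).
  by apply: freq_indep => // j jk; rewrite negb_and -leqNgt jk.
exact: (almost_periodic_mean_indep FG APk APk1 lk (@lP k.+1 km)).
Qed.

(** * Gaussian limit of one increment *)

Section Limit.
Variables (s h : R) (NB : nat -> nat).
Hypotheses (s0 : 0 <= s) (h0 : 0 < h).
Hypothesis indE : forall N, Q_lin_indep (NB N) (E N).
Hypothesis flNB : forall N, (fl N (s + h) <= NB N)%N.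
Hypothesis R1_cvg : forall s' h', 0 <= s' -> 0 <= h' -> s' + h' <= s + h ->
  R1 d N h' s' @[N --> \oo] --> h'.

Let ssh : s <= s + h. Proof. by rewrite lerDl ltW. Qed.

(* The blocks of a fine subdivision of [s, s + h] carry asymptotically equal
   shares of the variance, so no single amplitude survives in the limit. *)
Lemma amp_small e : 0 < e -> \forall N \near \oo,
  forall j, (fl N s < j <= fl N (s + h))%N -> amp N j ^+ 2 <= e.
Proof.
(* With [p > h / e] blocks, each limiting share [w] is strictly below [e], so the shares themselves
   are eventually at most [e]. *)
move=> e0; pose p := (Num.truncn (h / e)).+1; pose w := h / p%:R.
have p0 : 0 < p%:R :> R by rewrite ltr0n.
have w0 : 0 <= w by rewrite divr_ge0 ?(ltW h0) ?(ltW p0).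
have we : w < e.
  by rewrite /w ltr_pdivrMr// mulrC -ltr_pdivrMr//; exact: truncnS_gt.
have wp : p%:R * w = h by rewrite /w mulrC divfK// gt_eqF.
have blocks k : (k <= p)%N -> \forall N \near \oo, forall i, (i < k)%N -> R1 d N w (s + i%:R * w) <= e.
  elim: k => [_|k IHk kp]; first by near=> N.
  have near1 : \forall N \near \oo, R1 d N w (s + k%:R * w) <= e.
    apply: (cvgr_le w) => //; apply: R1_cvg => //.
      by rewrite addr_ge0// mulr_ge0.
    rewrite -addrA lerD2l -[X in _ + X]mul1r -mulrDl -wp ler_wpM2r//.
    by rewrite natr1 ler_nat.
  have near2 := IHk (ltnW kp).
  near=> N => i; rewrite ltnS leq_eqVlt => /orP[/eqP->|ik]; first by near: N.
  have H : forall i, (i < k)%N -> R1 d N w (s + i%:R * w) <= e by near: N.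
  exact: H.
have := blocks p (leqnn p); apply: filterS => N Rle j /andP[sj].
(* Induction on the number of blocks finds the one containing [j], where [amp N j ^+ 2] is a single
   summand of a share bounded by [e]. *)
rewrite -wp; elim: {-2}p (leqnn p) => [_|k IHk kp jk].
  by rewrite mul0r addr0 leqNgt sj.
have [jk'|kj] := leqP j (fl N (s + k%:R * w)); first exact: IHk (ltnW kp) jk'.
apply: le_trans (Rle k kp); rewrite -sum_amp_sqr.
have skE : s + k.+1%:R * w = s + k%:R * w + w by rewrite -natr1 mulrDl mul1r addrA.
rewrite (bigD1_seq j)/= ?iota_uniq ?mem_index_iota ?kj/= -?skE ?ltnS//.
by rewrite lerDl; apply: sumr_ge0 => i _; exact: sqr_ge0.
Unshelve. all: by end_near. Qed.

Lemma Wincr_cos_limit (a x1 x2 c : R) : exists l : nat -> R,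
  (forall N, time_avg_cvg (fun t => a * cos (x1 * (Wincr E d N s (s + h) t).1 +
     x2 * (Wincr E d N s (s + h) t).2 + c)) (l N)) /\
  l @ \oo --> a * (expR (- (h * (x1 ^+ 2 + x2 ^+ 2) / 4)) * cos c).
Proof.
pose A N := (fl N s).+1; pose B N := (fl N (s + h)).+1.
have AB N : (A N <= B N)%N by rewrite ltnS fl_mono.
have BE N : (B N = A N + (B N - A N))%N by rewrite subnKC.
pose S N := wave_sum (E N) (amp N) x1 x2 (A N) (B N).
have PS N : trigpoly (phase (freq (NB N) (E N) predT)) (S N).
  by apply: wave_sum_trigpoly => //; exact: flNB.
have /choice[l lP] : forall N, exists l, time_avg_cvg (fun t => cos (S N t + c)) l.
  by move=> N; apply: almost_periodic_mean (almost_periodic_cos c (freq_additive _ _ _) (PS N)).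
exists (fun N => a * l N); split=> [N|].
  have -> : (fun t => a * cos (x1 * (Wincr E d N s (s + h) t).1 +
     x2 * (Wincr E d N s (s + h) t).2 + c)) = (fun t => a * cos (S N t + c)).
    by apply/funext => t; rewrite Wincr_lin.
  apply: time_avgZ => //.
  exact: (almost_periodic_cos c (freq_additive _ _ _) (PS N)).1.
apply: cvgM; first exact: cvg_cst.
(* The Gaussian value at the actual variance [R1 d N h s]: [l N - q N] is the error of the mode by
   mode computation, and [q] converges by continuity. *)
pose q N := expR (- ((x1 ^+ 2 + x2 ^+ 2) / 4 * R1 d N h s)) * cos c.
have Rh : R1 d N h s @[N --> \oo] --> h by apply: R1_cvg => //; exact: ltW.
have qlim : q @ \oo --> expR (- (h * (x1 ^+ 2 + x2 ^+ 2) / 4)) * cos c.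
  apply: cvgM; last exact: cvg_cst.
  have -> : - (h * (x1 ^+ 2 + x2 ^+ 2) / 4) = - ((x1 ^+ 2 + x2 ^+ 2) / 4 * h) by field.
  apply: (cvg_comp (fun N => - ((x1 ^+ 2 + x2 ^+ 2) / 4 * R1 d N h s)) expR); last exact: continuous_expR.
  by apply: cvgN; apply: cvgM => //; exact: cvg_cst.
suff lq : (fun N => l N - q N) @ \oo --> 0.
  rewrite (_ : l = (fun N => l N - q N) \+ q); last by apply/funext => N /=; rewrite subrK.
  by rewrite -[X in _ --> X]add0r; exact: cvgD.
apply/cvgr0Pnorm_le => e e0.
pose r := `|x1| + `|x2|; pose K := 2 * r ^+ 4 + r ^+ 3.
have r0 : 0 <= r by rewrite addr_ge0.
have K0 : 0 <= K by rewrite addr_ge0 ?mulr_ge0 ?exprn_ge0.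
have h10 : 0 <= h + 1 by rewrite addr_ge0 ?(ltW h0).
have [dl /andP[dl0 dl1] dle] := small_factor (mulr_ge0 K0 h10) e0.
near=> N.
have R1h : R1 d N h s <= h + 1 by near: N; apply: (cvgr_le h) => //; rewrite ltrDl.
have small j : (fl N s < j <= fl N (s + h))%N -> amp N j ^+ 2 <= dl ^+ 2.
  by move: j; near: N; apply: amp_small; rewrite exprn_gt0.
have aN j : (A N <= j < A N + (B N - A N))%N -> `|amp N j| <= dl.
  rewrite -BE ltnS => /small; rewrite -[amp N j ^+ 2]real_normK ?num_real//.
  by rewrite ler_pXn2r ?nnegrE ?(ltW dl0).
have BNB : (A N + (B N - A N) <= (NB N).+1)%N by rewrite -BE ltnS.
have dl01 : 0 <= dl <= 1 by rewrite ltW.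
have [m mP mE] := @charfn_wave_sum R (NB N) (E N) (amp N) x1 x2 (@indE N) (A N) (B N - A N) dl c isT BNB dl01 aN.
move: mP mE; rewrite -BE sum_amp_sqr => /(time_avg_unique (lP N)) <- mE.
apply: le_trans mE _; apply: le_trans dle.
by rewrite [leRHS]mulrAC -/r -/K ler_wpM2l// mulr_ge0// ltW.
Unshelve. all: by end_near. Qed.

Lemma Wincr_continuous N : continuous (Wincr E d N s (s + h)).
Proof.
rewrite (_ : Wincr E d N s (s + h) = (fun t => (wave_sum (E N) (amp N) 1 0 (fl N s).+1 (fl N (s + h)).+1 t,
  wave_sum (E N) (amp N) 0 1 (fl N s).+1 (fl N (s + h)).+1 t))); last first.
  by apply/funext => t; rewrite WincrE.
have cS x1 x2 : continuous (wave_sum (E N) (amp N) x1 x2 (fl N s).+1 (fl N (s + h)).+1).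
  apply: (@trigpoly_continuous _ (freq (NB N) (E N) predT)).
  by apply: wave_sum_trigpoly => //; exact: flNB.
exact: continuous_pair2.
Qed.

Lemma Wincr_trigpoly_limit p : trigpoly (@linphase R) p -> exists l : nat -> R,
  (forall N, time_avg_cvg (fun t => p (Wincr E d N s (s + h) t)) (l N)) /\
  l @ \oo --> int_R2 (fun x => p x * gauss2 h x).
Proof.
have cW q : trigpoly (@linphase R) q -> forall N, continuous (fun t => q (Wincr E d N s (s + h) t)).
  by move=> Pq N t; apply: continuous_comp; [exact: Wincr_continuous|exact: trigpoly_linphase_continuous].
have ip q : trigpoly (@linphase R) q -> ((@lebesgue_measure R) \x (@lebesgue_measure R))%E.-integrable setT
    (EFin \o (fun x => q x * gauss2 h x)).
  move=> Pq; have [M M0 qM] := trigpoly_bounded Pq.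
  apply: (@integrable_gauss2M _ _ h0 _ M); first exact: trigpoly_measurable.
  by move=> x; apply: le_trans (qM x) _; rewrite ler_peMr// lerDl addr_ge0 ?sqr_ge0.
elim=> [a th [x1 [x2 [c thE]]]|f g Pf [l1 [l1P l1E]] Pg [l2 [l2P l2E]]].
  have thE' : th = (fun x => x1 * x.1 + x2 * x.2 + c) by exact/funext.
  have [l [lP lE]] := Wincr_cos_limit a x1 x2 c; exists l; rewrite thE'; split=> //.
  suff -> : int_R2 (fun x => a * cos (x1 * x.1 + x2 * x.2 + c) * gauss2 h x) =
      a * (expR (- (h * (x1 ^+ 2 + x2 ^+ 2) / 4)) * cos c) by [].
  rewrite -fourier_gauss2// /int_R2 -RintegralZl//.
    by apply: eq_Rintegral => x _; rewrite mulrA.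
  have := ip (fun x => 1 * cos (th x)) (trigpoly_cos 1 (ex_intro _ x1 (ex_intro _ x2 (ex_intro _ c thE)))).
  by apply: eq_integrable => // x _; rewrite /= mul1r thE.
exists (fun N => l1 N + l2 N); split=> [N|]; first by apply: time_avgD => //; exact: cW.
rewrite (_ : int_R2 _ = int_R2 (fun x => f x * gauss2 h x) + int_R2 (fun x => g x * gauss2 h x)).
  exact: cvgD.
rewrite /int_R2 -RintegralD//; [|exact: ip|exact: ip].
by apply: eq_Rintegral => x _; rewrite mulrDl.
Qed.

(** The coordinates are the wave sums for the directions (1, 0) and (0, 1), each with mean square
    half of [R1]. The identity is exact for every [N]. *)
Lemma Wincr_sqr_mean N : time_avg_cvg (fun t =>
  (Wincr E d N s (s + h) t).1 ^+ 2 + (Wincr E d N s (s + h) t).2 ^+ 2) (R1 d N h s).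
Proof.
have ff : ((fl N s).+1 <= (fl N (s + h)).+1)%N by rewrite ltnS fl_mono.
have mean x1 x2 := (@wave_sum_mean R (NB N) (E N) (amp N) x1 x2 (@indE N) (fl N s).+1
  ((fl N (s + h)).+1 - (fl N s).+1) isT _).2.
rewrite subnKC// in mean; have {}mean := mean (flNB N).
have cS x1 x2 : continuous (fun t => wave_sum (E N) (amp N) x1 x2 (fl N s).+1 (fl N (s + h)).+1 t ^+ 2).
  have Ps : trigpoly (phase (freq (NB N) (E N) predT)) (wave_sum (E N) (amp N) x1 x2 (fl N s).+1 (fl N (s + h)).+1).
    by apply: wave_sum_trigpoly => //; exact: flNB.
  exact: continuousMfun (trigpoly_continuous Ps) (trigpoly_continuous Ps).
under [X in time_avg_cvg X]funext do rewrite WincrE//=.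
have -> : R1 d N h s = (1 ^+ 2 + 0 ^+ 2) / 2 * R1 d N h s + (0 ^+ 2 + 1 ^+ 2) / 2 * R1 d N h s by field.
by rewrite -sum_amp_sqr; apply: time_avgD => //; exact: mean.
Qed.

Lemma Wincr_gauss_limit (g : R * R -> R) : bounded_continuous g -> exists L : nat -> R,
  (forall N, time_avg_cvg (fun t => g (Wincr E d N s (s + h) t)) (L N)) /\
  L @ \oo --> int_R2 (fun x => g x * gauss2 h x).
Proof.
move=> bg; have APg N := @almost_periodic_Wincr (NB N) N s (s + h) g predT ssh (flNB N) bg (fun _ _ => isT).
have /choice[L LP] : forall N, exists L, time_avg_cvg (fun t => g (Wincr E d N s (s + h) t)) L.
  by move=> N; apply: almost_periodic_mean (APg N).
exists L; split=> //; apply/cvgrPdist_le => e e0.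
pose G := int_R2 (fun x => (1 + (x.1 ^+ 2 + x.2 ^+ 2)) * gauss2 h x).
have G0 : 0 <= G.
  apply: Rintegral_ge0 => x _; rewrite mulr_ge0 ?gauss2_ge0//.
  by rewrite addr_ge0// addr_ge0 ?sqr_ge0.
(* [G] weighs the error of [p] under the Gaussian, and [h + 2] eventually bounds its weight 1 +
   [R1 d N h s] under the increment. *)
have K0 : 0 <= G + (h + 2) by rewrite !addr_ge0// ltW.
have e2 : 0 < e / 2 by rewrite divr_gt0.
have [dl /andP[dl0 _] dle] := small_factor K0 e2.
have [p Pp gp] := trigpoly_approx bg dl0.
have [l [lP lE]] := Wincr_trigpoly_limit Pp.
have pG := int_R2_gauss2_dist h0 (ltW dl0) bg Pp gp.
have Rh : R1 d N h s @[N --> \oo] --> h by apply: R1_cvg => //; exact: ltW.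
near=> N.
have R1h : R1 d N h s <= h + 1 by near: N; apply: (cvgr_le h) => //; rewrite ltrDl.
have lN : `|int_R2 (fun x => p x * gauss2 h x) - l N| <= e / 2.
  by near: N; move/cvgrPdist_le : lE => /(_ _ e2).
have Ll : `|L N - l N| <= dl * (1 + R1 d N h s).
  have cW := @Wincr_continuous N.
  have cp := trigpoly_linphase_continuous Pp.
  have cq : continuous (fun x : R * R => dl * (1 + (x.1 ^+ 2 + x.2 ^+ 2))).
    move=> x; apply: cvgM; first exact: cvg_cst.
    apply: cvgD; first exact: cvg_cst.
    by apply: cvgD; apply: cvgM; first [exact: cvg_fst|exact: cvg_snd].
  apply: (@time_avg_dist_fun _ (fun t => g (Wincr E d N s (s + h) t)) (fun t => p (Wincr E d N s (s + h) t))
    (fun t => dl * (1 + ((Wincr E d N s (s + h) t).1 ^+ 2 + (Wincr E d N s (s + h) t).2 ^+ 2)))) => //.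
  - by move=> t; apply: continuous_comp; [exact: cW|exact: bg.1].
  - by move=> t; apply: continuous_comp; [exact: cW|exact: cp].
  - move=> t; apply: (@continuous_comp _ _ _ (fun t => Wincr E d N s (s + h) t) (fun x : R * R => dl * (1 + (x.1 ^+ 2 + x.2 ^+ 2)))).
      exact: cW.
    exact: cq.
  - have cW2 : continuous (fun t => (Wincr E d N s (s + h) t).1 ^+ 2 + (Wincr E d N s (s + h) t).2 ^+ 2).
      move=> t; apply: (@continuous_comp _ _ _ (fun t => Wincr E d N s (s + h) t) (fun x : R * R => x.1 ^+ 2 + x.2 ^+ 2)).
        exact: cW.
      by apply: cvgD; apply: cvgM; first [exact: cvg_fst|exact: cvg_snd].
    apply: time_avgZ.
      by move=> t; apply: cvgD; [exact: cvg_cst|exact: cW2].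
    apply: (@time_avgD _ (fun=> 1)) => //; first by move=> ?; exact: cvg_cst.
      exact: time_avg_cst.
    exact: Wincr_sqr_mean.
rewrite -/G in pG.
have : dl * (G + (1 + R1 d N h s)) <= e / 2.
  by apply: le_trans dle; rewrite mulrC ler_wpM2r ?(ltW dl0)//; lra.
set I := int_R2 _ in pG *; set J := int_R2 _ in pG lN.
(* The outer terms replace [g] by [p] under the Gaussian and under the time average; the middle one
   is the convergence already known for [p]. *)
have -> : I - L N = (I - J) + (J - l N) - (L N - l N) by ring.
rewrite mulrDr => dG; apply: le_trans (ler_normB _ _) _.
have := ler_normD (I - J) (J - l N); lra.
Unshelve. all: by end_near. Qed.

End Limit.
End Increments.

Unset Implicit Arguments.

Theorem theorem3 (R : realType) (smax : R) (NB : nat -> nat)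
  (E d : nat -> nat -> R) :
  0 < smax ->
  (forall N : nat, (fl N smax <= NB N)%N) ->
  (forall N : nat, Q_lin_indep (NB N) (E N)) ->
  (forall N k : nat, (1 <= k <= NB N)%N -> 0 < d N k) ->
  (* (a) *)
  (exists q : R, 1 < q /\
     (fun N : nat => (\sum_(1 <= k < N.+1) (d N k ^+ 2) `^ q) / (DeltaZ2 d N) `^ q)
       @ \oo --> 0) ->
  (* (b) *)
  (forall s h : R, 0 <= s -> 0 <= h -> s + h <= smax ->
     (fun N : nat => R1 d N h s) @ \oo --> h) ->
  (* conclusion 1: for every N, the increments over 0 <= s_0 < ... < s_m <= smax
     are mutually independent under the infinite-time-average law of t *)
  (forall (N m : nat) (sv : nat -> R),
     0 <= sv 0%N -> (forall i, (i < m)%N -> sv i < sv i.+1) -> sv m <= smax ->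
     forall g : nat -> (R * R -> R),
       (forall i, (1 <= i <= m)%N -> bounded_continuous (g i)) ->
       exists l : nat -> R,
         (forall i, (1 <= i <= m)%N ->
            time_avg_cvg (fun t => g i (Wincr E d N (sv i.-1) (sv i) t)) (l i)) /\
         time_avg_cvg
           (fun t => \prod_(1 <= i < m.+1) g i (Wincr E d N (sv i.-1) (sv i) t))
           (\prod_(1 <= i < m.+1) l i))
  /\
  (* conclusion 2: W^N_{s+h} - W^N_s converges in distribution to the isotropic
     Gaussian on R^2 with density e^{-|x|^2/h}/(pi h) *)
  (forall s h : R, 0 <= s -> 0 < h -> s + h <= smax ->
     forall g : R * R -> R, bounded_continuous g ->
       exists L : nat -> R,
         (forall N : nat, time_avg_cvg (fun t => g (Wincr E d N s (s + h) t)) (L N)) /\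
         L @ \oo --> int_R2 (fun x => g x * gauss2 h x)).
Proof.
move=> smax0 flNB indE _ _ R1_cvg.
have flNB' N s : s <= smax -> (fl N s <= NB N)%N.
  by move=> ss; apply: leq_trans (flNB N); exact: fl_mono.
split=> [N m sv sv0 svS svm g bg|s h s0 h0 sh g bg].
  apply: (@Wincr_indep R E d (NB N) N m sv g (indE N) _ _ bg); first exact: flNB'.
  by move=> i im; apply: ltW; exact: svS.
apply: (Wincr_gauss_limit s0 h0 indE) => // [N|s' h' s'0 h'0 s'h']; first exact: flNB'.
by apply: R1_cvg => //; exact: le_trans sh.
Qed.
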